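(* Let $F$ be a field of arbitrary characteristic and let $(V,\varphi)$ be a nondegenerate ternary (i.e. $\dim_F V=3$) quadratic space over $F$. Then the alternative Clifford algebra $\operatorname{C}^{\operatorname{alt}}(\varphi)$ is an octonion ring whose center is (isomorphic to) the ring of polynomials in one variable over $F$.
   Context: A nonassociative ring $A$ is alternative if $(a,a,b)=(a,b,b)=0$ for all $a,b\in A$, where $(x,y,z)=(xy)z-x(yz)$ is the associator. The center of $A$ is the set of $a\in A$ with $(a,A,A)=(A,a,A)=(A,A,a)=0$ and $ax=xa$ for all $x\in A$. For a quadratic form $\varphi$ on a finite-dimensional $F$-vector space $V$, write $\varphi(v,w)=\varphi(v+w)-\varphi(v)-\varphi(w)$ for its symmetric bilinear form. The form is nondegenerate (standard convention, valid in every characteristic) if the radical of this bilinear form has dimension at most $1$ and $\varphi(x)\neq 0$ for every nonzero $x$ in the radical. The alternative Clifford algebra $\operatorname{C}^{\operatorname{alt}}(\varphi)$ (also written $\operatorname{C}^{\operatorname{alt}}(V,\varphi)$) is the alternative tensor algebra of $V$ modulo the relations $v^2=\varphi(v)\cdot 1$ for all $v\in V$; explicitly, it is the free (unital) alternative $F$-algebra generated by $x_1,\dots,x_n$ (a basis of $V$) modulo the relations $(u_1x_1+\cdots+u_nx_n)^2=\varphi(u_1,\dots,u_n)$ for all $u_1,\dots,u_n\in F$. An octonion algebra over a field $K$ is the Cayley--Dickson double $(Q,\gamma)_K=Q\oplus Qz$ of a quaternion algebra $Q$ over $K$ with $z^2=\gamma\in K^\times$. A ring $R$ with center $Z(R)$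 is an octonion ring if it is a faithful module over an integral domain $C\subseteq Z(R)$ such that $(C\setminus\{0\})^{-1}R$ is an octonion algebra (over the fraction field of $C$). *)

(* Defs.v *)
(* boolp provides the classical eqType and choiceType structures underlying the
   quotient algebras constructed below. *)
From HB Require Import structures.
From mathcomp Require Import all_boot all_order all_algebra all_field.
From mathcomp Require Import boolp.

Set Implicit Arguments.
Unset Strict Implicit.
Unset Printing Implicit Defensive.

Import GRing.Theory.
Local Open Scope ring_scope.
Local Open Scope quotient_scope.

Reserved Notation "x ** y" (at level 40, left associativity).

(* Unital, not necessarily associative rings; 0 = 1 is not excluded. *)
HB.mixin Record Zmodule_isNaRing R of GRing.Zmodule R := {
  naone : R;
  namul : R -> R -> R;
  namul1r : left_id naone namul;
  namulr1 : right_id naone namul;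
  namulDl : left_distributive namul +%R;
  namulDr : right_distributive namul +%R
}.

#[short(type="naRingType")]
HB.structure Definition NaRing := {R of GRing.Zmodule R & Zmodule_isNaRing R}.

Notation "x ** y" := (namul x y) : ring_scope.

HB.mixin Record NaRing_isNaAlg (F : fieldType) A
    of NaRing A & GRing.Lmodule F A := {
  nascaleAl : forall (a : F) (x y : A), a *: (x ** y) = (a *: x) ** y;
  nascaleAr : forall (a : F) (x y : A), a *: (x ** y) = x ** (a *: y)
}.

#[short(type="naAlgType")]
HB.structure Definition NaAlg (F : fieldType) :=
  {A of NaRing A & GRing.Lmodule F A & NaRing_isNaAlg F A}.

Section NaRingTheory.
Variable R : naRingType.
Implicit Types a b x y z : R.

Definition associator x y z : R := (x ** y) ** z - x ** (y ** z).

Definition alternative : Prop :=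
  forall a b, associator a a b = 0 /\ associator a b b = 0.

Definition in_center a : Prop :=
  (forall x y,
     [/\ associator a x y = 0, associator x a y = 0 & associator x y a = 0])
  /\ (forall x, a ** x = x ** a).

End NaRingTheory.

Section QuadraticForms.
Variables (F : fieldType) (V : vectType F).
Implicit Types (phi : V -> F) (v w : V).

Definition polar phi v w : F := phi (v + w) - phi v - phi w.

Definition quadratic_form phi : Prop :=
  [/\ forall (a : F) v, phi (a *: v) = a ^+ 2 * phi v,
      forall w, scalar (polar phi ^~ w)
    & forall v, scalar (polar phi v)].

Definition nondegenerate_quadratic phi : Prop :=
  exists rad : {vspace V},
    [/\ forall v, v \in rad <-> (forall w, polar phi v w = 0),
        (\dim rad <= 1)%N
      & forall v, v \in rad -> v != 0 -> phi v != 0].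

End QuadraticForms.

Section Presentation.
Variables (F : fieldType) (X : Type).

Inductive algTerm : Type :=
  | TGen of X
  | TZero
  | TOne
  | TOpp of algTerm
  | TAdd of algTerm & algTerm
  | TScale of F & algTerm
  | TMul of algTerm & algTerm.

HB.instance Definition _ := gen_eqMixin algTerm.
HB.instance Definition _ := gen_choiceMixin algTerm.

Variable rel : algTerm -> algTerm -> Prop.

(* The smallest congruence containing rel whose quotient is a unital
   alternative F-algebra. *)
Inductive altCong : algTerm -> algTerm -> Prop :=
  | ACrel s t : rel s t -> altCong s t
  | ACrefl s : altCong s s
  | ACsym s t : altCong s t -> altCong t s
  | ACtrans s t u : altCong s t -> altCong t u -> altCong s u
  | ACopp s s' : altCong s s' -> altCong (TOpp s) (TOpp s')
  | ACadd s s' t t' :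
      altCong s s' -> altCong t t' -> altCong (TAdd s t) (TAdd s' t')
  | ACscale a s s' : altCong s s' -> altCong (TScale a s) (TScale a s')
  | ACmul s s' t t' :
      altCong s s' -> altCong t t' -> altCong (TMul s t) (TMul s' t')
  | ACaddA s t u : altCong (TAdd s (TAdd t u)) (TAdd (TAdd s t) u)
  | ACaddC s t : altCong (TAdd s t) (TAdd t s)
  | ACadd0 s : altCong (TAdd TZero s) s
  | ACaddN s : altCong (TAdd (TOpp s) s) TZero
  | ACscaleA a b s : altCong (TScale a (TScale b s)) (TScale (a * b) s)
  | ACscale1 s : altCong (TScale 1 s) s
  | ACscaleDr a s t :
      altCong (TScale a (TAdd s t)) (TAdd (TScale a s) (TScale a t))
  | ACscaleDl a b s :
      altCong (TScale (a + b) s) (TAdd (TScale a s) (TScale b s))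
  | ACmul1l s : altCong (TMul TOne s) s
  | ACmul1r s : altCong (TMul s TOne) s
  | ACmulDl s t u :
      altCong (TMul (TAdd s t) u) (TAdd (TMul s u) (TMul t u))
  | ACmulDr s t u :
      altCong (TMul s (TAdd t u)) (TAdd (TMul s t) (TMul s u))
  | ACscaleAl a s t : altCong (TScale a (TMul s t)) (TMul (TScale a s) t)
  | ACscaleAr a s t : altCong (TScale a (TMul s t)) (TMul s (TScale a t))
  | ACaltl s t : altCong (TMul (TMul s s) t) (TMul s (TMul s t))
  | ACaltr s t : altCong (TMul (TMul s t) t) (TMul s (TMul t t)).

Definition altCongb (s t : algTerm) : bool := `[< altCong s t >].

Lemma altCongb_refl : reflexive altCongb.
Proof. by move=> s; apply/asboolP/ACrefl. Qed.

Lemma altCongb_sym : symmetric altCongb.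
Proof. by move=> s t; apply/asboolP/asboolP => /ACsym. Qed.

Lemma altCongb_trans : transitive altCongb.
Proof. by move=> t s u /asboolP st /asboolP /(ACtrans st) ?; apply/asboolP. Qed.

Canonical altCongb_equiv :=
  EquivRel altCongb altCongb_refl altCongb_sym altCongb_trans.

(* The unital alternative F-algebra with generators X and relations rel. *)
Definition altPres : Type := {eq_quot altCongb}.
HB.instance Definition _ := Choice.on altPres.
HB.instance Definition _ := EqQuotient.on altPres.

Lemma altPresP s t : \pi_altPres s = \pi_altPres t <-> altCong s t.
Proof. by split=> [/eqmodP/asboolP|st]; last exact/eqmodP/asboolP. Qed.

Let repr_cong s : altCong (repr (\pi_altPres s)) s.
Proof. by apply/altPresP; rewrite reprK. Qed.

Definition ap_zero : altPres := \pi_altPres TZero.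
Definition ap_one : altPres := \pi_altPres TOne.
Definition ap_opp := lift_op1 altPres TOpp.
Definition ap_add := lift_op2 altPres TAdd.
Definition ap_scale (a : F) := lift_op1 altPres (TScale a).
Definition ap_mul := lift_op2 altPres TMul.

Let ap_oppE s : ap_opp (\pi_altPres s) = \pi_altPres (TOpp s).
Proof. by unlock ap_opp; apply/altPresP/ACopp/repr_cong. Qed.
Let ap_addE s t :
  ap_add (\pi_altPres s) (\pi_altPres t) = \pi_altPres (TAdd s t).
Proof. by unlock ap_add; apply/altPresP/ACadd; apply: repr_cong. Qed.
Let ap_scaleE a s : ap_scale a (\pi_altPres s) = \pi_altPres (TScale a s).
Proof. by rewrite /ap_scale; unlock; apply/altPresP/ACscale/repr_cong. Qed.
Let ap_mulE s t :
  ap_mul (\pi_altPres s) (\pi_altPres t) = \pi_altPres (TMul s t).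
Proof. by unlock ap_mul; apply/altPresP/ACmul; apply: repr_cong. Qed.

Let apE := (ap_oppE, ap_addE, ap_scaleE, ap_mulE).

Let ap_addA : associative ap_add.
Proof.
elim/quotW=> s; elim/quotW=> t; elim/quotW=> u; rewrite !apE.
exact/altPresP/ACaddA.
Qed.
Let ap_addC : commutative ap_add.
Proof.
by elim/quotW=> s; elim/quotW=> t; rewrite !apE; apply/altPresP/ACaddC.
Qed.
Let ap_add0 : left_id ap_zero ap_add.
Proof. by elim/quotW=> s; rewrite !apE; apply/altPresP/ACadd0. Qed.
Let ap_addN : left_inverse ap_zero ap_opp ap_add.
Proof. by elim/quotW=> s; rewrite !apE; apply/altPresP/ACaddN. Qed.

HB.instance Definition _ :=
  GRing.isZmodule.Build altPres ap_addA ap_addC ap_add0 ap_addN.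

Let ap_scaleA a b x : ap_scale a (ap_scale b x) = ap_scale (a * b) x.
Proof. by elim/quotW: x => s; rewrite !apE; apply/altPresP/ACscaleA. Qed.
Let ap_scale1 : left_id 1 ap_scale.
Proof. by elim/quotW=> s; rewrite !apE; apply/altPresP/ACscale1. Qed.
Let ap_scaleDr : right_distributive ap_scale +%R.
Proof.
move=> a; elim/quotW=> s; elim/quotW=> t; rewrite /GRing.add /= !apE.
exact/altPresP/ACscaleDr.
Qed.
Let ap_scaleDl x : {morph ap_scale^~ x : a b / a + b}.
Proof.
elim/quotW: x => s a b; rewrite [RHS]/GRing.add /= !apE.
exact/altPresP/ACscaleDl.
Qed.

HB.instance Definition _ :=
  GRing.Zmodule_isLmodule.Build F altPres
    ap_scaleA ap_scale1 ap_scaleDr ap_scaleDl.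

Let ap_mul1l : left_id ap_one ap_mul.
Proof. by elim/quotW=> s; rewrite !apE; apply/altPresP/ACmul1l. Qed.
Let ap_mul1r : right_id ap_one ap_mul.
Proof. by elim/quotW=> s; rewrite !apE; apply/altPresP/ACmul1r. Qed.
Let ap_mulDl : left_distributive ap_mul +%R.
Proof.
elim/quotW=> s; elim/quotW=> t; elim/quotW=> u; rewrite /GRing.add /= !apE.
exact/altPresP/ACmulDl.
Qed.
Let ap_mulDr : right_distributive ap_mul +%R.
Proof.
elim/quotW=> s; elim/quotW=> t; elim/quotW=> u; rewrite /GRing.add /= !apE.
exact/altPresP/ACmulDr.
Qed.

HB.instance Definition _ :=
  Zmodule_isNaRing.Build altPres ap_mul1l ap_mul1r ap_mulDl ap_mulDr.

Let ap_scaleAl (a : F) (x y : altPres) : a *: (x ** y) = (a *: x) ** y.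
Proof.
elim/quotW: x => s; elim/quotW: y => t.
by rewrite /namul /GRing.scale /= !apE; apply/altPresP/ACscaleAl.
Qed.
Let ap_scaleAr (a : F) (x y : altPres) : a *: (x ** y) = x ** (a *: y).
Proof.
elim/quotW: x => s; elim/quotW: y => t.
by rewrite /namul /GRing.scale /= !apE; apply/altPresP/ACscaleAr.
Qed.

HB.instance Definition _ :=
  NaRing_isNaAlg.Build F altPres ap_scaleAl ap_scaleAr.

Lemma pi_TOne : \pi_altPres TOne = naone.
Proof. by []. Qed.
Lemma pi_TZero : \pi_altPres TZero = 0.
Proof. by []. Qed.
Lemma pi_TOpp s : \pi_altPres (TOpp s) = - \pi_altPres s.
Proof. by rewrite /GRing.opp /= ap_oppE. Qed.
Lemma pi_TAdd s t : \pi_altPres (TAdd s t) = \pi_altPres s + \pi_altPres t.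
Proof. by rewrite /GRing.add /= ap_addE. Qed.
Lemma pi_TScale a s : \pi_altPres (TScale a s) = a *: \pi_altPres s.
Proof. by rewrite /GRing.scale /= ap_scaleE. Qed.
Lemma pi_TMul s t : \pi_altPres (TMul s t) = \pi_altPres s ** \pi_altPres t.
Proof. by rewrite /namul /= ap_mulE. Qed.

Definition pi_termE :=
  (pi_TOne, pi_TZero, pi_TOpp, pi_TAdd, pi_TScale, pi_TMul).

Lemma altPres_alternative : alternative altPres.
Proof.
elim/quotW=> s; elim/quotW=> t; rewrite /associator -!pi_termE.
by split; rewrite !pi_termE; apply/eqP; rewrite subr_eq0 -!pi_termE;
   apply/eqP/altPresP; [apply: ACaltl | apply: ACaltr].
Qed.

End Presentation.

Section CliffordAlgebra.
Variables (F : fieldType) (V : vectType F) (phi : V -> F).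

Inductive cliffordRel : algTerm F V -> algTerm F V -> Prop :=
  | CRlin a u v :
      cliffordRel (TGen F (a *: u + v)) (TAdd (TScale a (TGen F u)) (TGen F v))
  | CRsqr v :
      cliffordRel (TMul (TGen F v) (TGen F v)) (TScale (phi v) (TOne F V)).

Definition altClifford : Type := altPres cliffordRel.
HB.instance Definition _ := NaAlg.on altClifford.

Definition cliffordGen (v : V) : altClifford :=
  \pi_(altPres cliffordRel) (TGen F v).

Lemma altClifford_alternative : alternative altClifford.
Proof. exact: altPres_alternative. Qed.

Lemma cliffordGen_linear : linear cliffordGen.
Proof.
move=> a u v; rewrite /cliffordGen -!(pi_TScale, pi_TAdd).
exact/altPresP/ACrel/CRlin.
Qed.

Lemma cliffordGen_sqr v : cliffordGen v ** cliffordGen v = phi v *: naone.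
Proof.
rewrite /cliffordGen -pi_TMul -pi_TOne -pi_TScale.
exact/altPresP/ACrel/CRsqr.
Qed.

Section UniversalProperty.
Variables (A : naAlgType F) (f : V -> A).
Hypotheses (Aalt : alternative A) (flin : linear f).
Hypothesis fsqr : forall v, f v ** f v = phi v *: naone.

Fixpoint termEval (t : algTerm F V) : A :=
  match t with
  | TGen v => f v
  | TZero => 0
  | TOne => naone
  | TOpp s => - termEval s
  | TAdd s u => termEval s + termEval u
  | TScale a s => a *: termEval s
  | TMul s u => termEval s ** termEval u
  end.

Lemma termEval_cong s t : altCong cliffordRel s t -> termEval s = termEval t.
Proof.
elim=> {s t} //=.
- by move=> s t []; [move=> a u v; exact: flin | exact: fsqr].
- by move=> s t u _ -> _ ->.
- by move=> s s' _ ->.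
- by move=> s s' t t' _ -> _ ->.
- by move=> a s s' _ ->.
- by move=> s s' t t' _ -> _ ->.
- by move=> *; exact: addrA.
- by move=> *; exact: addrC.
- by move=> *; exact: add0r.
- by move=> *; exact: addNr.
- by move=> *; exact: scalerA.
- by move=> *; exact: scale1r.
- by move=> *; exact: scalerDr.
- by move=> *; exact: scalerDl.
- by move=> *; exact: namul1r.
- by move=> *; exact: namulr1.
- by move=> *; exact: namulDl.
- by move=> *; exact: namulDr.
- by move=> *; exact: nascaleAl.
- by move=> *; exact: nascaleAr.
- move=> s t; apply/eqP; rewrite -subr_eq0; apply/eqP.
  by case: (Aalt (termEval s) (termEval t)).
- move=> s t; apply/eqP; rewrite -subr_eq0; apply/eqP.
  by case: (Aalt (termEval s) (termEval t)).
Qed.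

Lemma altClifford_universal :
  exists! g : altClifford -> A,
    [/\ linear g, g naone = naone, {morph g : x y / x ** y}
      & forall v, g (cliffordGen v) = f v].
Proof.
pose g (x : altClifford) := termEval (repr (x : altPres cliffordRel)).
have gE s : g (\pi_(altPres cliffordRel) s) = termEval s.
  by apply/termEval_cong/altPresP; rewrite reprK.
exists g; split; first split.
- move=> a; elim/quotW=> s; elim/quotW=> t.
  by rewrite -pi_TScale -pi_TAdd !gE.
- exact: (gE (TOne F V)).
- by elim/quotW=> s; elim/quotW=> t; rewrite -pi_TMul !gE.
- by move=> v; exact: gE.
move=> h [hlin h1 hM hgen]; apply/funext; elim/quotW=> s; rewrite gE.
have hD x y : h (x + y) = h x + h y by rewrite -[x]scale1r hlin !scale1r.
have h0 : h 0 = 0 by apply: (addrI (h 0)); rewrite -hD !addr0.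
have hZ a x : h (a *: x) = a *: h x by rewrite -[a *: x]addr0 hlin h0 addr0.
have hN x : h (- x) = - h x by rewrite -scaleN1r hZ scaleN1r.
elim: s => [v|||s IHs|s IHs t IHt|a s IHs|s IHs t IHt] /=.
- by rewrite -hgen.
- by rewrite pi_TZero h0.
- by rewrite pi_TOne h1.
- by rewrite pi_TOpp hN -IHs.
- by rewrite pi_TAdd hD -IHs -IHt.
- by rewrite pi_TScale hZ -IHs.
- by rewrite pi_TMul hM -IHs -IHt.
Qed.

End UniversalProperty.

End CliffordAlgebra.

Section OctonionAlgebras.
Variable K : fieldType.

(* A four-dimensional central simple algebra. *)
Definition quaternion_algebra (Q : falgType K) : Prop :=
  [/\ \dim {:Q} = 4%N,
      'Z({:Q})%VS = 1%VS
    & forall I : {vspace Q},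
        ({:Q} * I <= I)%VS -> (I * {:Q} <= I)%VS -> I = 0%VS \/ I = fullv].

(* On a quaternion algebra this determines sigma uniquely: it is the canonical
   involution (reduced trace minus identity), in every characteristic. *)
Definition standard_involution (Q : falgType K) (sigma : Q -> Q) : Prop :=
  [/\ linear sigma, involutive sigma,
      forall x y, sigma (x * y) = sigma y * sigma x
    & forall x, x + sigma x \in 1%VS /\ x * sigma x \in 1%VS].

(* Here (a, b) stands for a + b z. *)
Definition cd_mul (Q : falgType K) (sigma : Q -> Q) (gamma : K) (p q : Q * Q) :
    Q * Q :=
  (p.1 * q.1 + gamma *: (sigma q.2 * p.2), q.2 * p.1 + p.2 * sigma q.1).

Definition octonion_algebra (L : naAlgType K) : Prop :=
  exists (Q : falgType K) (sigma : Q -> Q) (gamma : K) (h : Q * Q -> L),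
    [/\ quaternion_algebra Q, standard_involution sigma, gamma != 0
      & [/\ linear h, bijective h, h (1, 0) = naone
          & forall p q, h (cd_mul sigma gamma p q) = h p ** h q]].

End OctonionAlgebras.

(* loc exhibits L as the localization of R at the nonzero elements of C, the
   latter acting on R through the central embedding iota: the elements of L are
   the fractions loc x / c, and loc x vanishes iff some nonzero c kills x. *)
Definition is_localization (R : naRingType) (C : idomainType) (iota : C -> R)
    (L : naAlgType {fraction C}) (loc : R -> L) : Prop :=
  [/\ {morph loc : x y / x + y}, loc naone = naone,
      {morph loc : x y / x ** y}
    & [/\ forall c x, loc (iota c ** x) = FracField.tofrac c *: loc x,
          forall y, exists c x, c != 0 /\ y = (FracField.tofrac c)^-1 *: loc x
        & forall x, loc x = 0 <-> exists2 c, c != 0 & iota c ** x = 0]].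

(* The subring C of Z(R) is given as an abstract integral domain with an
   injective unital ring morphism iota into Z(R). *)
Definition octonion_ring (R : naRingType) : Prop :=
  exists (C : idomainType) (iota : C -> R),
    [/\ [/\ {morph iota : c d / c + d}, iota 1 = naone,
            {morph iota : c d / c * d >-> c ** d} & injective iota],
        forall c, in_center (iota c),
        forall c, (forall x, iota c ** x = 0) -> c = 0
      & exists (L : naAlgType {fraction C}) (loc : R -> L),
          is_localization iota loc /\ octonion_algebra L].

Definition center_iso_poly (F : fieldType) (A : naAlgType F) : Prop :=
  exists f : {poly F} -> A,
    [/\ linear f, f 1 = naone, {morph f : p q / p * q >-> p ** q},
        injective f & forall a, in_center a <-> exists p, f p = a].

(* Main.v *)
Require Import Defs.
From HB Require Import structures.
From mathcomp Require Import all_boot all_order all_algebra all_field.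
From mathcomp Require Import ring boolp.

Set Implicit Arguments.
Unset Strict Implicit.
Unset Printing Implicit Defensive.

Import GRing.Theory.

(** Let x, y, z be a basis of V with z orthogonal to x and y and with the form
    nondegenerate on the plane of x and y; write C for the alternative Clifford
    algebra, m for the polar form at (x, y), D = m^2 - 4 phi(x) phi(y), and
    e = xy - yx = 2 xy - m, so that e^2 = D is a nonzero scalar.

    In an octonion algebra generated by such x, y, z the only datum left free
    by the relations is the trace of (xy)z. In C this trace is the element
    T = (xy)z + z(xy) - m z, and everything rests on T being central. The
    linearized alternative laws show that T is invariant under cyclic
    permutations of x, y, z, hence commutes with each of them. Associativity
    comes from the left Moufang identity L_g L_t L_g = L_(gtg): if t commutes
    with g and g^2 is an invertible scalar, then L_t commutes with L_g, which
    yields (t, g, C) = 0 outside characteristic 2. In characteristic 2 the same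
    argument works for elements g that are quadratic with nonzero trace, such as
    xy, xy + x, xy + y and xy + z. Finally the elements r with (T, r, C) = 0
    form a subalgebra, because the Kleinfeld function is alternating. Hence T is
    central (clifford_trace_central).

    Over F[T] the element w = z - (T / D) e is orthogonal to the quaternions
    spanned by 1, x, y, xy, and w^2 = phi(z) - T^2 / D. In any alternative ring
    this forces the Cayley-Dickson multiplication rules (cd_embedM), so C is the
    image of the Cayley-Dickson double of quaternions with coefficients in F[T]
    (clifford_of_pair_surj). Conversely the octonion algebra O over F(t) with
    the same structure constants, viewed over F, contains a copy of V by
    z |-> (t / D) e + w; here t is transcendental, so phi(z) - t^2 / D is
    nonzero. The universal property gives a morphism from C to O under which
    pairs of quaternions over F[T] keep their coordinates (clifford_to_octo).
    Therefore C is the double over F[t] embedded in O: its localization is O,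
    and its center is F[t], since an element of O commuting with x, y and xy is
    a scalar. *)

(** * Cancellation in abelian groups *)

Section ZmoduleIdentities.
Local Open Scope ring_scope.
Variable U : zmodType.
Implicit Types r s u v : U.

Lemma sum_pull0 u : u = 0 + u. Proof. by rewrite add0r. Qed.
Lemma sum_pull r s u v : r = s + u -> r + v = s + v + u.
Proof. by move=> ->; rewrite addrAC. Qed.
Lemma sum_cancel s r u : s = r - u -> r = 0 -> s + u = 0.
Proof. by move=> -> ->; rewrite subrK. Qed.
Lemma sum_cancelN s r u : s = r + u -> r = 0 -> s - u = 0.
Proof. by move=> -> ->; rewrite addrK. Qed.
Lemma eq_of_sub0 u v : u - v = 0 -> u = v.
Proof. by move/eqP; rewrite subr_eq0 => /eqP. Qed.

End ZmoduleIdentities.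

(* Terms are compared up to conversion, since canonical instances reached along
   different inheritance paths are only convertible. *)
Ltac same u v := constr_eq u v + unify u v.

(* For a left-nested sum s with u among its terms, a proof of s = r + u for
   some r; [pullN] does this for the term - u. *)
Ltac pull s u :=
  match s with
  | (?r + ?v)%R =>
      let _ := match goal with _ => same u v end in constr:(erefl s)
  | (?r + ?v)%R => let p := pull r u in constr:(sum_pull v p)
  | ?v =>
      let _ := match goal with _ => same u v end in constr:(sum_pull0 v)
  end.

Ltac pullN s u :=
  match s with
  | (?r - ?v)%R =>
      let _ := match goal with _ => same u v end in constr:(erefl s)
  | (?r + ?v)%R => let p := pullN r u in constr:(sum_pull v p)
  | (- ?v)%R =>
      let _ := match goal with _ => same u v end in constr:(sum_pull0 s)
  end.

Ltac zcancel :=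
  lazymatch goal with
  | |- (0 = 0)%R => reflexivity
  | |- (?s - ?u = 0)%R =>
      let p := pull s u in apply: (sum_cancelN p); zcancel
  | |- (?s + ?u = 0)%R =>
      let p := pullN s u in apply: (sum_cancel p); zcancel
  end.

(* Matching is syntactic, so that definitions standing for sums stay folded. *)
Ltac zflatten :=
  repeat lazymatch goal with
  | |- context [(- (?u + ?v))%R] => rewrite (opprD u v)
  | |- context [(- - ?u)%R] => rewrite (opprK u)
  | |- context [(- 0)%R] => rewrite oppr0
  | |- context [(?u + (?v + ?w))%R] => rewrite (addrA u v w)
  | |- context [(?u + 0)%R] => rewrite (addr0 u)
  | |- context [(0 + ?u)%R] => rewrite (add0r u)
  end.

(** Decides equality of signed sums of atoms: both sides are moved to the left,
    flattened, and each term is cancelled against its opposite. *)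
Ltac zmod := apply: eq_of_sub0; zflatten; zcancel.

(** * Alternative rings and the Moufang identities *)

Section AlternativeRings.
Local Open Scope ring_scope.
Variable A : naRingType.
Implicit Types a b g r s t u v w x y z : A.

Lemma naring0l x : 0 ** x = 0.
Proof. by apply: (addrI (0 ** x)); rewrite -namulDl !addr0. Qed.
Lemma naring0r x : x ** 0 = 0.
Proof. by apply: (addrI (x ** 0)); rewrite -namulDr !addr0. Qed.
Lemma namulNl x y : (- x) ** y = - (x ** y).
Proof. by apply: (addrI (x ** y)); rewrite -namulDl !subrr naring0l. Qed.
Lemma namulNr x y : x ** (- y) = - (x ** y).
Proof. by apply: (addrI (x ** y)); rewrite -namulDr !subrr naring0r. Qed.

Definition namulE := (@namulDl A, @namulDr A, namulNl, namulNr).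

Lemma associatorE x y z : (x ** y) ** z = x ** (y ** z) + associator x y z.
Proof. by rewrite /associator; zmod. Qed.

Lemma associatorDl u v y z :
  associator (u + v) y z = associator u y z + associator v y z.
Proof. by rewrite /associator !namulE; zmod. Qed.
Lemma associatorDm x u v z :
  associator x (u + v) z = associator x u z + associator x v z.
Proof. by rewrite /associator !namulE; zmod. Qed.
Lemma associatorDr x y u v :
  associator x y (u + v) = associator x y u + associator x y v.
Proof. by rewrite /associator !namulE; zmod. Qed.

(** The Teichmueller identity: the associator is the coboundary of the product,
    hence a cocycle. *)
Lemma associator_cocycle w x y z :
  associator (w ** x) y z - associator w (x ** y) z + associator w x (y ** z)
  = w ** associator x y z + associator w x y ** z.
Proof. by rewrite /associator !namulE; zmod. Qed.

Hypothesis altA : alternative A.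

Lemma associatorll x z : associator x x z = 0. Proof. by case: (altA x z). Qed.
Lemma associatorrr x z : associator x z z = 0. Proof. by case: (altA x z). Qed.

Lemma associatorCl x y z : associator y x z = - associator x y z.
Proof.
have := associatorll (x + y) z.
rewrite associatorDl !associatorDm !associatorll addr0 add0r => yx_xy.
by apply: eq_of_sub0; rewrite opprK -yx_xy; zmod.
Qed.

Lemma associatorCr x y z : associator x z y = - associator x y z.
Proof.
have := associatorrr x (y + z).
rewrite associatorDm !associatorDr !associatorrr addr0 add0r => zy_yz.
by apply: eq_of_sub0; rewrite opprK -zy_yz; zmod.
Qed.

Lemma associator_cycle x y z : associator y z x = associator x y z.
Proof. by rewrite associatorCr associatorCl opprK. Qed.

Lemma associatorlr x y : associator x y x = 0.
Proof. by rewrite associator_cycle associatorll. Qed.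

Lemma namul_altl x y : (x ** x) ** y = x ** (x ** y).
Proof. by rewrite associatorE associatorll addr0. Qed.
Lemma namul_altr x y : (x ** y) ** y = x ** (y ** y).
Proof. by rewrite associatorE associatorrr addr0. Qed.
Lemma namul_flex x y : (x ** y) ** x = x ** (y ** x).
Proof. by rewrite associatorE associatorlr addr0. Qed.

Lemma namul_lin_altl x y z :
  x ** (y ** z) + y ** (x ** z) = (x ** y + y ** x) ** z.
Proof. by rewrite namulDl !associatorE (associatorCl x y); zmod. Qed.
Lemma namul_lin_altr x y z :
  (x ** y) ** z + (x ** z) ** y = x ** (y ** z + z ** y).
Proof. by rewrite namulDr !associatorE (associatorCr x y); zmod. Qed.

(** The failure of w |-> (w, y, z) to be a derivation, up to the order of the
    factors. *)
Definition kleinfeld w x y z : A :=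
  associator (w ** x) y z - x ** associator w y z - associator x y z ** w.

Lemma kleinfeldCr w x y z : kleinfeld w x z y = - kleinfeld w x y z.
Proof.
rewrite /kleinfeld ![associator _ z y]associatorCr !namulE.
by zmod.
Qed.

(** In an alternative ring the sum of the cocycle identities for (w, x, y, z)
    and (z, w, x, y) consists of these two values, all other terms cancelling by
    the alternation of the associator. *)
Lemma kleinfeld_cycle w x y z : kleinfeld y z w x = - kleinfeld z w x y.
Proof.
have e1 := associator_cocycle w x y z; have e2 := associator_cocycle z w x y.
have c1 : associator w x (y ** z) = associator (y ** z) w x.
  by rewrite associator_cycle.
have c2 : associator z (w ** x) y = associator (w ** x) y z.
  by rewrite 2!associator_cycle.
have c3 : associator z w (x ** y) = associator w (x ** y) z.
  by rewrite 2!associator_cycle.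
rewrite c1 in e1; rewrite c2 c3 in e2; have e := congr2 +%R e1 e2.
rewrite /kleinfeld -[associator y w x]associator_cycle.
rewrite -[associator z x y]associator_cycle.
move/eqP: e; rewrite -subr_eq0 => /eqP e; apply: eq_of_sub0; rewrite opprK -e.
by zmod.
Qed.

(** Equal adjacent arguments can be cycled to the last two places, where the
    vanishing is visible term by term even in characteristic 2. *)
Lemma kleinfeldmm w x z : kleinfeld w x x z = 0.
Proof.
do 3!rewrite kleinfeld_cycle ?opprK.
by rewrite /kleinfeld !associatorrr naring0r naring0l !subr0 oppr0.
Qed.

Lemma associator_mulm w x z : associator (w ** x) x z = x ** associator w x z.
Proof.
have := kleinfeldmm w x z.
by rewrite /kleinfeld associatorll naring0l subr0; apply: eq_of_sub0.
Qed.

Lemma associator_mull w x z : associator (w ** x) w z = associator x w z ** w.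
Proof.
have : kleinfeld w x w z = 0.
  by rewrite kleinfeldCr 2!kleinfeld_cycle kleinfeldmm !oppr0.
rewrite /kleinfeld associatorll naring0r subr0; exact: eq_of_sub0.
Qed.

Lemma left_moufang g t s : ((g ** t) ** g) ** s = g ** (t ** (g ** s)).
Proof.
rewrite associatorE associator_mull associatorE.
rewrite (associator_cycle (g ** s)) associator_mull.
rewrite (associator_cycle s t g) (associatorCr s g t) namulNl.
by zmod.
Qed.

Lemma middle_moufang w x y : (w ** x) ** (y ** w) = (w ** (x ** y)) ** w.
Proof.
rewrite namul_flex !associatorE (associator_cycle (y ** w)) associator_mulm.
by rewrite (associator_cycle x) -namulDr.
Qed.

Definition associates_with t r : Prop := forall s, associator t r s = 0.

(** Two cyclic shifts turn this value into [kleinfeld s w t r], all of whose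
    terms contain t and r in one associator. *)
Lemma kleinfeld_associates t r s w :
  associates_with t r -> kleinfeld t r s w = 0.
Proof.
move=> tr; rewrite kleinfeld_cycle kleinfeld_cycle opprK /kleinfeld.
rewrite -[associator s t r]associator_cycle -[associator w t r]associator_cycle.
rewrite -[associator (s ** w) t r]associator_cycle.
by rewrite !tr naring0r naring0l !subr0.
Qed.

(** The vanishing of [kleinfeld r s t w] says that (rs, t, w) is a combination
    of (r, t, w) and (s, t, w). *)
Lemma associates_withM t r s :
  associates_with t r -> associates_with t s -> associates_with t (r ** s).
Proof.
move=> tr ts w.
have : kleinfeld r s t w = 0.
  by rewrite kleinfeldCr 3!kleinfeld_cycle kleinfeld_associates // !oppr0.
rewrite /kleinfeld (associatorCl t r) (associatorCl t s) tr ts oppr0.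
by rewrite naring0r naring0l !subr0 => h; rewrite associatorCl h oppr0.
Qed.

End AlternativeRings.

(** * The trace element of three generators *)

Section TraceElement.
Local Open Scope ring_scope.
Variables (F : fieldType) (A : naAlgType F).
Implicit Types g r s t u v : A.
Local Notation "k %:S" := (k *: (naone : A)) (at level 2, format "k %:S").

Lemma nascalarl (k : F) u : k%:S ** u = k *: u.
Proof. by rewrite -nascaleAl namul1r. Qed.
Lemma nascalarr (k : F) u : u ** k%:S = k *: u.
Proof. by rewrite -nascaleAr namulr1. Qed.

Lemma nascalarM (k l : F) : k%:S ** l%:S = (k * l)%:S.
Proof. by rewrite nascalarl scalerA. Qed.

Hypothesis altA : alternative A.

Lemma comm_anticommutator v r (k : F) :
  v ** v = k%:S -> (r ** v + v ** r) ** v = v ** (r ** v + v ** r).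
Proof.
move=> vv; rewrite namulDl namulDr namul_altr // namul_flex // vv.
by rewrite -namul_altl // vv nascalarl nascalarr addrC.
Qed.

(** The left Moufang identity reads L_g L_t L_g = L_(gtg) = k L_t. Multiplying
    by L_g gives k L_t L_g = k L_g L_t, and then linearized left alternativity
    gives 2 L_(tg) = L_t L_g + L_g L_t = 2 L_t L_g. *)
Lemma associates_with_sqr t g (k : F) : (2%:R : F) != 0 -> k != 0 ->
  g ** g = k%:S -> t ** g = g ** t -> associates_with t g.
Proof.
move=> two_neq0 k_neq0 gg tg s.
have gtg u : g ** (t ** (g ** u)) = k *: (t ** u).
  by rewrite -left_moufang // -tg namul_altr // gg nascalarr nascaleAl.
have tgs : t ** (g ** s) = g ** (t ** s).
  apply: (scalerI k_neq0).
  by rewrite -gtg -namul_altl // gg nascalarl -!nascaleAr.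
have := namul_lin_altl altA t g s; rewrite -tgs -tg namulDl -!mulr2n.
rewrite -!scaler_nat => /(scalerI two_neq0) tgsE.
by rewrite /associator tgsE subrr.
Qed.

(** Here L_t and L_g commute by linearized left alternativity alone. The left
    Moufang identity L_(t g^2) = L_g L_t L_g = L_t L_(g^2), expanded along the
    quadratic equation of g, reduces to k L_(tg) = k L_t L_g. *)
Lemma associates_with_char2 t g (k l n : F) : (2%:R : F) = 0 -> k != 0 ->
  g ** g = k *: g + n%:S + l *: t -> t ** g = g ** t -> associates_with t g.
Proof.
move=> two0 k_neq0 gg tg s.
have add2 u : u + u = 0 by rewrite -mulr2n -scaler_nat two0 scale0r.
have tgs : t ** (g ** s) = g ** (t ** s).
  have := namul_lin_altl altA t g s; rewrite -tg namulDl add2 => h.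
  by rewrite -[LHS]addr0 -(add2 (g ** (t ** s))) addrA h add0r.
have := left_moufang altA g t s; rewrite tgs -namul_altl // -tg.
rewrite namul_altr // gg.
rewrite !namulDl !namulDr !namulDl nascalarl nascalarr.
rewrite -!nascaleAr -!nascaleAl namul_altl //.
move=> /addIr/addIr/(scalerI k_neq0) tgsE.
by rewrite /associator tgsE tgs subrr.
Qed.

Variables (x y z : A) (a b c m : F).
Hypotheses (xx : x ** x = a%:S) (yy : y ** y = b%:S) (zz : z ** z = c%:S).
Hypotheses (xy : x ** y + y ** x = m%:S).
Hypotheses (xz : x ** z + z ** x = 0) (yz : y ** z + z ** y = 0).

Local Notation p := (x ** y).
(** For trace-zero octonions x, y, z with z orthogonal to x and y this is the
    trace of (xy)z. *)
Definition trace_elt : A := x ** y ** z + z ** (x ** y) - m *: z.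
Local Notation T := trace_elt.

Lemma trace_eltE : T = z ** p - (y ** x) ** z.
Proof.
have -> : y ** x = m%:S - p by rewrite -xy; zmod.
by rewrite namulDl namulNl nascalarl /trace_elt; zmod.
Qed.

(** Invariance under cyclic permutations makes T an anticommutator with x and
    with y, as it is by definition with z up to a multiple of z; and an
    anticommutator with v commutes with v when v^2 is a scalar. *)
Lemma trace_elt_yzx : T = (y ** z) ** x + x ** (y ** z).
Proof.
have e1 : z ** p = x ** (y ** z).
  have zx0 : z ** x + x ** z = 0 by rewrite addrC.
  have h1 := namul_lin_altl altA z x y; rewrite zx0 naring0l in h1.
  by apply: (addIr (x ** (z ** y))); rewrite h1 -namulDr yz naring0r.
have e2 : (y ** z) ** x = - ((y ** x) ** z).
  apply: eq_of_sub0; rewrite opprK addrC namul_lin_altr // xz naring0r //.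
by rewrite trace_eltE e1 e2 addrC.
Qed.

Lemma trace_elt_zxy : T = (z ** x) ** y + y ** (z ** x).
Proof.
have e1 : (z ** x) ** y = p ** z.
  have h1 := namul_lin_altr altA x y z; rewrite yz naring0r in h1.
  apply: (addIr ((x ** z) ** y)).
  by rewrite h1 -namulDl (addrC (z ** x)) xz naring0l.
have e2 : y ** (z ** x) = - (z ** (y ** x)).
  apply: eq_of_sub0; rewrite opprK namul_lin_altl // yz naring0l //.
rewrite e1 e2 /trace_elt; have -> : p = m%:S - y ** x by rewrite -xy; zmod.
by rewrite namulDl namulDr namulNl namulNr nascalarl nascalarr; zmod.
Qed.

Lemma trace_elt_commx : T ** x = x ** T.
Proof. by rewrite trace_elt_yzx; exact: comm_anticommutator xx. Qed.
Lemma trace_elt_commy : T ** y = y ** T.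
Proof. by rewrite trace_elt_zxy; exact: comm_anticommutator yy. Qed.
Lemma trace_elt_commz : T ** z = z ** T.
Proof.
rewrite /trace_elt namulDl (comm_anticommutator p zz) !namulDr namulNl namulNr.
by rewrite -nascaleAl -nascaleAr.
Qed.

Lemma sqr_xy : p ** p = m *: p - (a * b)%:S.
Proof.
have -> : p ** p = p ** (m%:S - y ** x) by rewrite -xy; congr (_ ** _); zmod.
rewrite namulDr namulNr nascalarr middle_moufang // yy nascalarr.
by rewrite -nascaleAl xx scalerA mulrC.
Qed.

Lemma trace_elt_commxy : T ** p = p ** T.
Proof.
rewrite /trace_elt !namulDl !namulDr !namulNl !namulNr -nascaleAl -nascaleAr.
rewrite namul_altr // namul_flex // -namul_altl // sqr_xy.
rewrite !namulDl !namulDr namulNl namulNr nascalarl nascalarr.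
by rewrite -nascaleAl -nascaleAr; zmod.
Qed.

Lemma anticommutator_xy_x : p ** x + x ** p = m *: x.
Proof. by rewrite namul_flex // -namulDr addrC xy nascalarr. Qed.
Lemma anticommutator_xy_y : p ** y + y ** p = m *: y.
Proof.
by rewrite addrC -namul_flex // -namulDl addrC xy nascalarl.
Qed.

(** In characteristic not 2 the generators have invertible squares. In
    characteristic 2 the elements xy, xy + x, xy + y and xy + z commute with T
    and satisfy quadratic equations of nonzero trace m; the constant term of the
    last one involves T. *)
Lemma trace_elt_associates :
  [/\ (2%:R : F) != 0, a != 0, b != 0 & c != 0] \/
  (2%:R : F) = 0 /\ m != 0 ->
  [/\ associates_with T x, associates_with T y & associates_with T z].
Proof.
case=> [[two_neq0 a_neq0 b_neq0 c_neq0]|[two0 m_neq0]].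
  split.
  - exact: associates_with_sqr two_neq0 a_neq0 xx trace_elt_commx.
  - exact: associates_with_sqr two_neq0 b_neq0 yy trace_elt_commy.
  - exact: associates_with_sqr two_neq0 c_neq0 zz trace_elt_commz.
have Tp : associates_with T p.
  apply: (associates_with_char2 (n := - (a * b)) (l := 0) two0 m_neq0).
    by rewrite sqr_xy scale0r addr0 scaleNr.
  exact: trace_elt_commxy.
have sub v : associates_with T (p + v) -> associates_with T v.
  by move=> Tpv s; have := Tpv s; rewrite associatorDm Tp add0r.
have quad v (n l : F) : v ** v = n%:S -> p ** v + v ** p = m *: v + l *: T ->
    T ** v = v ** T -> associates_with T v.
  move=> vv pv Tv; apply: sub.
  apply: (associates_with_char2 (n := n - a * b) (l := l) two0 m_neq0).
    rewrite namulDl !namulDr sqr_xy vv scalerBl.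
    rewrite addrA -(addrA _ (p ** v)) pv (scalerDr m p v); move: T => t.
    by zmod.
  by rewrite (namulDr T) (namulDl p) trace_elt_commxy Tv.
split.
- apply: (quad x a 0 xx); last exact: trace_elt_commx.
  by rewrite scale0r addr0 anticommutator_xy_x.
- apply: (quad y b 0 yy); last exact: trace_elt_commy.
  by rewrite scale0r addr0 anticommutator_xy_y.
apply: (quad z c 1 zz); last exact: trace_elt_commz.
by rewrite scale1r /trace_elt; zmod.
Qed.

End TraceElement.

(** * Quaternions over a commutative ring *)

Section QuaternionRing.
Local Open Scope ring_scope.

(** The quadruple (k0, k1, k2, k3) stands for k0 + k1 x + k2 y + k3 xy, where
    x^2 = a, y^2 = b and xy + yx = m. The parameters select the multiplication
    attached to the type; allowing m to be nonzero covers characteristic 2. *)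
Definition quat (R : comNzRingType) (a b m : R) : Type := (R * R * R * R)%type.

Variables (R : comNzRingType) (a b m : R).
Local Notation Q := (quat a b m).
Implicit Types (u v w : Q) (k : R).

HB.instance Definition _ :=
  GRing.Lmodule.copy Q (R^o * R^o * R^o * R^o)%type.

Definition Quat (k0 k1 k2 k3 : R) : Q := (k0, k1, k2, k3).

Definition quat_one : Q := Quat 1 0 0 0.
Definition quat_mul u v : Q :=
  let: (u0, u1, u2, u3) := u in let: (v0, v1, v2, v3) := v in
  Quat (u0 * v0 + a * u1 * v1 + b * u2 * v2 + m * u2 * v1 - a * b * u3 * v3)
       (u0 * v1 + u1 * v0 - b * u2 * v3 + m * u3 * v1 + b * u3 * v2)
       (u0 * v2 + u2 * v0 + a * u1 * v3 + m * u2 * v3 - a * u3 * v1)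
       (u0 * v3 + u3 * v0 + u1 * v2 - u2 * v1 + m * u3 * v3).
Definition quat_conj u : Q :=
  let: (u0, u1, u2, u3) := u in Quat (u0 + m * u3) (- u1) (- u2) (- u3).
Definition quat_tr u : R := let: (u0, u1, u2, u3) := u in u0 *+ 2 + m * u3.
Definition quat_norm u : R :=
  let: (u0, u1, u2, u3) := u in
  u0 ^+ 2 + m * u0 * u3 + a * b * u3 ^+ 2
  - a * u1 ^+ 2 - b * u2 ^+ 2 - m * u1 * u2.

Lemma addQE k0 k1 k2 k3 l0 l1 l2 l3 :
  Quat k0 k1 k2 k3 + Quat l0 l1 l2 l3
  = Quat (k0 + l0) (k1 + l1) (k2 + l2) (k3 + l3).
Proof. by []. Qed.
Lemma oppQE k0 k1 k2 k3 :
  - Quat k0 k1 k2 k3 = Quat (- k0) (- k1) (- k2) (- k3).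
Proof. by []. Qed.
Lemma scaleQE k k0 k1 k2 k3 :
  k *: Quat k0 k1 k2 k3 = Quat (k * k0) (k * k1) (k * k2) (k * k3).
Proof. by []. Qed.

Lemma quatP u : exists k0 k1 k2 k3, u = Quat k0 k1 k2 k3.
Proof. by case: u => [[[k0 k1] k2] k3]; exists k0, k1, k2, k3. Qed.

Lemma quat_mulA : associative quat_mul.
Proof.
move=> [[[u0 u1] u2] u3] [[[v0 v1] v2] v3] [[[w0 w1] w2] w3].
rewrite /quat_mul /Quat; congr (_, _, _, _); ring.
Qed.
Lemma quat_mul1q : left_id quat_one quat_mul.
Proof.
move=> [[[u0 u1] u2] u3]; rewrite /quat_mul /Quat /=; congr (_, _, _, _); ring.
Qed.
Lemma quat_mulq1 : right_id quat_one quat_mul.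
Proof.
move=> [[[u0 u1] u2] u3]; rewrite /quat_mul /Quat /=; congr (_, _, _, _); ring.
Qed.
Lemma quat_mulDl : left_distributive quat_mul +%R.
Proof.
move=> [[[u0 u1] u2] u3] [[[v0 v1] v2] v3] [[[w0 w1] w2] w3].
rewrite -/(Quat u0 u1 u2 u3) -/(Quat v0 v1 v2 v3) addQE.
rewrite /quat_mul /Quat addQE; congr (_, _, _, _); ring.
Qed.
Lemma quat_mulDr : right_distributive quat_mul +%R.
Proof.
move=> [[[u0 u1] u2] u3] [[[v0 v1] v2] v3] [[[w0 w1] w2] w3].
rewrite -/(Quat v0 v1 v2 v3) -/(Quat w0 w1 w2 w3) addQE.
rewrite /quat_mul /Quat addQE; congr (_, _, _, _); ring.
Qed.
Lemma quat_oner_neq0 : quat_one != 0.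
Proof. by apply/eqP=> -[/eqP]; rewrite oner_eq0. Qed.

HB.instance Definition _ := GRing.Zmodule_isNzRing.Build Q
  quat_mulA quat_mul1q quat_mulq1 quat_mulDl quat_mulDr quat_oner_neq0.

Lemma mulQE k0 k1 k2 k3 l0 l1 l2 l3 :
  Quat k0 k1 k2 k3 * Quat l0 l1 l2 l3 =
  Quat (k0 * l0 + a * k1 * l1 + b * k2 * l2 + m * k2 * l1 - a * b * k3 * l3)
       (k0 * l1 + k1 * l0 - b * k2 * l3 + m * k3 * l1 + b * k3 * l2)
       (k0 * l2 + k2 * l0 + a * k1 * l3 + m * k2 * l3 - a * k3 * l1)
       (k0 * l3 + k3 * l0 + k1 * l2 - k2 * l1 + m * k3 * l3).
Proof. by []. Qed.

Lemma oneQE : 1 = Quat 1 0 0 0. Proof. by []. Qed.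
Lemma conjQE k0 k1 k2 k3 :
  quat_conj (Quat k0 k1 k2 k3) = Quat (k0 + m * k3) (- k1) (- k2) (- k3).
Proof. by []. Qed.

Lemma quat_scaleAl k u v : k *: (u * v) = (k *: u) * v.
Proof.
have [u0 [u1 [u2 [u3 ->]]]] := quatP u; have [v0 [v1 [v2 [v3 ->]]]] := quatP v.
rewrite !(scaleQE, mulQE); congr Quat; ring.
Qed.
Lemma quat_scaleAr k u v : k *: (u * v) = u * (k *: v).
Proof.
have [u0 [u1 [u2 [u3 ->]]]] := quatP u; have [v0 [v1 [v2 [v3 ->]]]] := quatP v.
rewrite !(scaleQE, mulQE); congr Quat; ring.
Qed.

HB.instance Definition _ := GRing.Lmodule_isLalgebra.Build R Q quat_scaleAl.
HB.instance Definition _ := GRing.Lalgebra_isAlgebra.Build R Q quat_scaleAr.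

Lemma quat_conj_linear : linear quat_conj.
Proof.
move=> k u v.
have [u0 [u1 [u2 [u3 ->]]]] := quatP u; have [v0 [v1 [v2 [v3 ->]]]] := quatP v.
rewrite scaleQE addQE !conjQE scaleQE addQE; congr Quat; ring.
Qed.

Lemma quat_conjD u v : quat_conj (u + v) = quat_conj u + quat_conj v.
Proof. by rewrite -[u]scale1r quat_conj_linear !scale1r. Qed.

Lemma quat_conjZ k u : quat_conj (k *: u) = k *: quat_conj u.
Proof.
have [u0 [u1 [u2 [u3 ->]]]] := quatP u.
rewrite scaleQE !conjQE scaleQE; congr Quat; ring.
Qed.

Lemma quat_conj0 : quat_conj 0 = 0 :> Q.
Proof. by rewrite -(scale0r (0 : Q)) quat_conjZ !scale0r. Qed.

Lemma quat_conjK : involutive quat_conj.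
Proof.
move=> u; have [u0 [u1 [u2 [u3 ->]]]] := quatP u.
rewrite !conjQE; congr Quat; ring.
Qed.

Lemma quat_conjM u v : quat_conj (u * v) = quat_conj v * quat_conj u.
Proof.
have [u0 [u1 [u2 [u3 ->]]]] := quatP u; have [v0 [v1 [v2 [v3 ->]]]] := quatP v.
rewrite !(conjQE, mulQE); congr Quat; ring.
Qed.

Lemma quat_trE u : u + quat_conj u = (quat_tr u)%:A.
Proof.
have [u0 [u1 [u2 [u3 ->]]]] := quatP u.
rewrite conjQE addQE oneQE scaleQE /=; congr Quat; ring.
Qed.

Lemma quat_normE u : u * quat_conj u = (quat_norm u)%:A.
Proof.
have [u0 [u1 [u2 [u3 ->]]]] := quatP u.
rewrite conjQE mulQE oneQE scaleQE /=; congr Quat; ring.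
Qed.

Lemma quat_conj_normE u : quat_conj u * u = (quat_norm u)%:A.
Proof.
have [u0 [u1 [u2 [u3 ->]]]] := quatP u.
rewrite conjQE mulQE oneQE scaleQE /=; congr Quat; ring.
Qed.

Lemma quat_conj_tr u : quat_conj u = (quat_tr u)%:A - u.
Proof. by rewrite -quat_trE addrAC subrr add0r. Qed.

Lemma quat_conj1 : quat_conj (1 : Q) = 1.
Proof. by rewrite oneQE conjQE; congr Quat; ring. Qed.

(** The discriminant both of the equation p^2 - m p + ab = 0 of p = xy and of
    the binary form a k^2 + m k l + b l^2. The trace form of the quaternions has
    determinant minus its square. *)
Definition quat_disc : R := m ^+ 2 - a * b *+ 4.

Definition quat_x : Q := Quat 0 1 0 0.
Definition quat_y : Q := Quat 0 0 1 0.
(** This is xy - yx, which is orthogonal to 1, x and y. *)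
Definition quat_e : Q := Quat (- m) 0 0 2%:R.

Lemma quat_e_sqr : quat_e * quat_e = quat_disc%:A.
Proof.
by rewrite /quat_e oneQE scaleQE mulQE /quat_disc; congr Quat => /=; ring.
Qed.

Lemma quat_xy_conj : quat_x * quat_y - quat_conj (quat_x * quat_y) = quat_e.
Proof.
rewrite /quat_x /quat_y mulQE conjQE oppQE addQE /quat_e.
by congr Quat => /=; ring.
Qed.

Lemma quat_e_trace :
  quat_x * quat_y * quat_e + quat_e * (quat_x * quat_y)
  = m *: quat_e + quat_disc%:A.
Proof.
rewrite /quat_x /quat_y /quat_e !mulQE oneQE !scaleQE !addQE /quat_disc.
congr Quat => /=; ring.
Qed.

End QuaternionRing.
Arguments quat_conj : simpl never.

Section QuaternionMap.
Local Open Scope ring_scope.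

Definition quat_map (R S : comNzRingType) (f : R -> S) (a b m : R)
    (u : quat a b m) : quat (f a) (f b) (f m) :=
  let: (u0, u1, u2, u3) := u in Quat _ _ _ (f u0) (f u1) (f u2) (f u3).

Variables (R S : comNzRingType) (f : {rmorphism R -> S}) (a b m : R).

Lemma quat_mapZ k (u : quat a b m) : quat_map f (k *: u) = f k *: quat_map f u.
Proof.
have [u0 [u1 [u2 [u3 ->]]]] := quatP u.
by rewrite scaleQE /quat_map /= scaleQE !rmorphM.
Qed.

Lemma quat_map_e : quat_map f (quat_e a b m) = quat_e (f a) (f b) (f m).
Proof. by rewrite /quat_map /quat_e /= rmorphN rmorph0 rmorph_nat. Qed.

Lemma quat_map_inj : injective f -> injective (@quat_map R S f a b m).
Proof.
move=> f_inj u v.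
have [u0 [u1 [u2 [u3 ->]]]] := quatP u; have [v0 [v1 [v2 [v3 ->]]]] := quatP v.
by rewrite /quat_map /= => -[/f_inj-> /f_inj-> /f_inj-> /f_inj->].
Qed.

End QuaternionMap.

(** * Quaternion algebras over a field *)

Section QuaternionField.
Local Open Scope ring_scope.
Variables (K : fieldType) (a b m : K).
Local Notation Q := (quat a b m).
Local Notation D := (quat_disc a b m).
Local Notation qx := (quat_x a b m).
Local Notation qy := (quat_y a b m).

HB.instance Definition _ := Vector.copy Q (K^o * K^o * K^o * K^o)%type.
HB.instance Definition _ := Algebra_isFalgebra.Build K Q.

Hypothesis D_neq0 : D != 0.

Lemma quat_scalar_mem (k : K) : (k%:A : Q) \in 1%VS.
Proof. by apply/vlineP; exists k. Qed.

(** Commutation with x makes the coordinates k at y and xy satisfy mk = 0 and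
    2abk = 0, hence D k = 0; commutation with y does this at x. *)
Lemma quat_commutant (u : Q) :
  u * qx = qx * u -> u * qy = qy * u -> exists k, u = k%:A.
Proof.
have [u0 [u1 [u2 [u3 ->]]]] := quatP u.
have Dker k : m * k = 0 -> a * b * k *+ 2 = 0 -> k = 0.
  move=> mk abk; apply: (mulfI D_neq0); rewrite mulr0 /quat_disc.
  transitivity (m * (m * k) - (a * b * k *+ 2) *+ 2); first by ring.
  by rewrite mk abk; ring.
rewrite /quat_x /quat_y !mulQE => -[x0 x1 x2 x3] [y0 _ _ y3]; exists u0.
have -> : u1 = 0.
  apply: Dker; [have /eqP := y0 | have /eqP := y3]; rewrite -subr_eq0 => /eqP h.
    by rewrite -[LHS]opprK -[RHS]oppr0 -[in RHS]h; congr (- _); ring.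
  by rewrite -mulrnAr -[RHS](mulr0 (a * b)) -[in RHS]h; ring.
have -> : u2 = 0.
  apply: Dker; [have /eqP := x0 | have /eqP := x3]; rewrite -subr_eq0 => /eqP h.
    by rewrite -[RHS]h; ring.
  by rewrite -mulrnAr -[RHS](mulr0 (- (a * b))) -[in RHS]h; ring.
have -> : u3 = 0.
  apply: Dker; [have /eqP := x1 | have /eqP := x2]; rewrite -subr_eq0 => /eqP h.
    by rewrite -[RHS]h; ring.
  by rewrite -mulrnAr -[RHS](mulr0 (- b)) -[in RHS]h; ring.
by rewrite oneQE scaleQE; congr Quat; ring.
Qed.

(** The right factors are D times the basis dual to 1, x, y, xy for the trace
    form, and such a sum is always central. It shows that a two-sided ideal
    containing v contains D tr(v). *)
Lemma quat_casimir (v : Q) :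
  v * Quat a b m (m ^+ 2 - a * b *+ 2) 0 0 (- m)
  + qx * v * Quat a b m 0 (- (b *+ 2)) m 0
  + qy * v * Quat a b m 0 m (- (a *+ 2)) 0
  + qx * qy * v * Quat a b m (- m) 0 0 2%:R
  = (D * quat_tr v)%:A.
Proof.
have [v0 [v1 [v2 [v3 ->]]]] := quatP v; rewrite /quat_x /quat_y.
rewrite !mulQE !addQE oneQE scaleQE /quat_disc /=; congr Quat; ring.
Qed.

Lemma quat_tr_nondeg (u : Q) : (forall v, quat_tr (u * v) = 0) -> u = 0.
Proof.
have [u0 [u1 [u2 [u3 ->]]]] := quatP u => tr0.
have := tr0 (Quat a b m 1 0 0 0); have := tr0 (Quat a b m 0 1 0 0).
have := tr0 (Quat a b m 0 0 1 0); have := tr0 (Quat a b m 0 0 0 1).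
rewrite !mulQE /= => e3 e2 e1 e0.
have Dk k : D * k = 0 -> k = 0.
  by move/eqP; rewrite mulf_eq0 (negPf D_neq0) => /eqP.
have {}e0 : u0 *+ 2 + m * u3 = 0 by rewrite -[RHS]e0; ring.
have {}e1 : a * u1 *+ 2 + m * u2 = 0 by rewrite -[RHS]e1; ring.
have {}e2 : b * u2 *+ 2 + m * u1 = 0 by rewrite -[RHS]e2; ring.
have {}e3 : m * u0 + m ^+ 2 * u3 - a * b * u3 *+ 2 = 0.
  by rewrite -[RHS]e3; ring.
(* The equations form two systems, in (u0, u3) and in (u1, u2), solved by
   Cramer's rule with determinants D and -D. *)
have D0 : D * u0 = 0.
  transitivity ((m ^+ 2 - a * b *+ 2) * (u0 *+ 2 + m * u3)
    - m * (m * u0 + m ^+ 2 * u3 - a * b * u3 *+ 2)).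
    by rewrite /quat_disc; ring.
  by rewrite e0 e3; ring.
have D1 : D * u1 = 0.
  transitivity (m * (b * u2 *+ 2 + m * u1)
    - (b *+ 2) * (a * u1 *+ 2 + m * u2)); first by rewrite /quat_disc; ring.
  by rewrite e1 e2; ring.
have D2 : D * u2 = 0.
  transitivity (m * (a * u1 *+ 2 + m * u2)
    - (a *+ 2) * (b * u2 *+ 2 + m * u1)); first by rewrite /quat_disc; ring.
  by rewrite e1 e2; ring.
have D3 : D * u3 = 0.
  transitivity ((m * u0 + m ^+ 2 * u3 - a * b * u3 *+ 2) *+ 2
    - m * (u0 *+ 2 + m * u3)); first by rewrite /quat_disc; ring.
  by rewrite e0 e3; ring.
by rewrite (Dk _ D0) (Dk _ D1) (Dk _ D2) (Dk _ D3).
Qed.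

Lemma quat_simple (I : {vspace Q}) :
  ({:Q} * I <= I)%VS -> (I * {:Q} <= I)%VS -> I = 0%VS \/ I = fullv.
Proof.
move=> /prodvP QI /prodvP IQ.
have [->|I_neq0] := eqVneq I 0%VS; [by left | right].
have mulI u v w : v \in I -> u * v * w \in I.
  by move=> Iv; apply: IQ; [apply: QI | ]; rewrite ?memvf.
have trI v : v \in I -> (D * quat_tr v)%:A \in I.
  move=> Iv; rewrite -quat_casimir !rpredD ?mulI //.
  by rewrite -[v]mul1r mulI.
have /existsNP[v /eqP tr_v] : ~ forall v, quat_tr (vpick I * v) = 0.
  by move/quat_tr_nondeg/eqP; rewrite vpick0 (negPf I_neq0).
have : (D * quat_tr (vpick I * v))%:A \in I.
  by apply: trI; rewrite -[vpick I]mul1r mulI ?memv_pick.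
rewrite rpredZeq mulf_eq0 (negPf D_neq0) (negPf tr_v) /= => I1.
apply/eqP; rewrite eqEsubv subvf; apply/subvP => w _.
by rewrite -[w]mulr1 -[w * 1]mulr1 mulI.
Qed.

Lemma quat_quaternion : quaternion_algebra Q.
Proof.
split; [by rewrite dimvf | | exact: quat_simple].
apply/eqP; rewrite eqEsubv; apply/andP; split; apply/subvP => u.
  rewrite memv_cap memvf => /centvP uC.
  have ux := uC qx (memvf _); have uy := uC qy (memvf _).
  by have [k ->] := quat_commutant ux uy; apply: quat_scalar_mem.
move=> /vlineP[k ->]; rewrite memv_cap memvf; apply/centvP => v _.
by rewrite -scalerAl -scalerAr mul1r mulr1.
Qed.

Lemma quat_standard : standard_involution (@quat_conj K a b m : Q -> Q).
Proof.
split; [exact: quat_conj_linear | exact: quat_conjK | exact: quat_conjM |].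
by move=> u; rewrite quat_trE quat_normE !quat_scalar_mem.
Qed.

End QuaternionField.

(** * Octonion algebras over a field *)

Section OctonionAlgebra.
Local Open Scope ring_scope.

(** The parameter g is the square of the Cayley-Dickson generator (0, 1). *)
Definition octo (K : fieldType) (a b m g : K) : Type :=
  (quat a b m * quat a b m)%type.

Variables (K : fieldType) (a b m g : K).
Local Notation Q := (quat a b m).
Local Notation O := (octo a b m g).
Implicit Types (p q r : O) (k l : K).

HB.instance Definition _ := GRing.Zmodule.copy O (Q * Q)%type.

(** Written out by components instead of copied from the product module: the
    conversion problems raised by later instances are then shallow. *)
Definition octo_scale k p : O := (k *: p.1, k *: p.2).

Lemma octo_scaleA k l p : octo_scale k (octo_scale l p) = octo_scale (k * l) p.
Proof. by case: p => p1 p2; rewrite /octo_scale /= !scalerA. Qed.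
Lemma octo_scale1 : left_id 1 octo_scale.
Proof. by case=> p1 p2; rewrite /octo_scale /= !scale1r. Qed.
Lemma octo_scaleDr : right_distributive octo_scale +%R.
Proof. by move=> k [p1 p2] [q1 q2]; congr (_, _); apply: scalerDr. Qed.
Lemma octo_scaleDl p : {morph octo_scale^~ p : k l / k + l}.
Proof. by case: p => p1 p2 k l; congr (_, _); apply: scalerDl. Qed.

HB.instance Definition _ := GRing.Zmodule_isLmodule.Build K O
  octo_scaleA octo_scale1 octo_scaleDr octo_scaleDl.

Definition octo_mul p q : O := cd_mul (@quat_conj K a b m) g p q.

Lemma octo_mul1p : left_id ((1, 0) : O) octo_mul.
Proof.
move=> [p q]; rewrite /octo_mul /cd_mul /= mul1r mulr1 mul0r mulr0 scaler0.
by rewrite !addr0.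
Qed.
Lemma octo_mulp1 : right_id ((1, 0) : O) octo_mul.
Proof.
move=> [p q]; rewrite /octo_mul /cd_mul /= quat_conj0 quat_conj1.
by rewrite !mul0r !mulr1 scaler0 addr0 add0r.
Qed.
Lemma octo_mulDl : left_distributive octo_mul +%R.
Proof.
move=> [p1 p2] [q1 q2] [r1 r2]; congr (_, _) => /=.
  by rewrite mulrDl mulrDr scalerDr; zmod.
by rewrite mulrDr mulrDl; zmod.
Qed.
Lemma octo_mulDr : right_distributive octo_mul +%R.
Proof.
move=> [p1 p2] [q1 q2] [r1 r2]; congr (_, _) => /=.
  by rewrite quat_conjD mulrDl mulrDr scalerDr; zmod.
by rewrite quat_conjD mulrDr mulrDl; zmod.
Qed.

HB.instance Definition _ := Zmodule_isNaRing.Build O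
  octo_mul1p octo_mulp1 octo_mulDl octo_mulDr.

Lemma octo_scaleAl (k : K) p q : k *: (p ** q) = (k *: p) ** q.
Proof.
case: p q => [p1 p2] [q1 q2]; congr (_, _) => /=.
  by rewrite scalerDr -scalerAl -scalerAr !scalerA (mulrC k).
by rewrite scalerDr -scalerAl -scalerAr.
Qed.
Lemma octo_scaleAr (k : K) p q : k *: (p ** q) = p ** (k *: q).
Proof.
case: p q => [p1 p2] [q1 q2]; congr (_, _) => /=.
  by rewrite scalerDr quat_conjZ -scalerAl -scalerAr !scalerA (mulrC k).
by rewrite quat_conjZ scalerDr -scalerAl -scalerAr.
Qed.

HB.instance Definition _ := NaRing_isNaAlg.Build K O octo_scaleAl octo_scaleAr.

Lemma octo_mulE (p1 p2 q1 q2 : Q) :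
  ((p1, p2) : O) ** ((q1, q2) : O) =
  (p1 * q1 + g *: (quat_conj q2 * p2), q2 * p1 + p2 * quat_conj q1).
Proof. by []. Qed.

Lemma octo_mul_quatl (p q1 q2 : Q) :
  ((p, 0) : O) ** ((q1, q2) : O) = (p * q1, q2 * p).
Proof. by rewrite octo_mulE mulr0 mul0r scaler0 !addr0. Qed.

Lemma octo_mul_quatr (p q1 q2 : Q) :
  ((q1, q2) : O) ** ((p, 0) : O) = (q1 * p, q2 * quat_conj p).
Proof. by rewrite octo_mulE quat_conj0 !mul0r scaler0 addr0 add0r. Qed.

Lemma octo_sqr (p1 p2 : Q) :
  ((p1, p2) : O) ** ((p1, p2) : O) =
  (p1 * p1 + (g * quat_norm p2)%:A, quat_tr p1 *: p2).
Proof.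
rewrite octo_mulE -mulrDr quat_trE quat_conj_normE scalerA.
by rewrite -scalerAr mulr1.
Qed.

(** The quaternions are associative, and their traces and norms are central
    scalars; substituting tr(p) - p for conjugates makes both sides equal. *)
Lemma octo_alternative : alternative O.
Proof.
move=> [p1 p2] [q1 q2].
split; apply/eqP; rewrite subr_eq0 octo_sqr !octo_mulE; apply/eqP;
  congr (_, _) => /=.
- rewrite quat_conjD !quat_conjM quat_conjK (quat_conj_tr p1) !mulrDl !mulNr.
  rewrite -!scalerAl !mul1r -scalerAr -(mulrA q1) quat_conj_normE -scalerAr.
  rewrite mulr1 !mulrDr -scalerAr !scalerDr !scalerN !scalerA !mulrA.
  by zmod.
- rewrite quat_conjD quat_conjZ !quat_conjM quat_conjK (quat_conj_tr p1).
  rewrite !mulrDr !mulrDl !mulrN -!scalerAl -!scalerAr !mulr1 (mulrA p2 _ q2).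
  rewrite quat_normE -scalerAl mul1r scalerA !mulrA.
  by zmod.
- rewrite quat_conjZ !mulrDr !mulrDl (mulrA _ q2) quat_conj_normE.
  rewrite (quat_conj_tr q1) !mulrDr !mulrN -!scalerAl -!scalerAr !mulr1 mul1r.
  rewrite !scalerDr !scalerN !scalerA !mulrA.
  by zmod.
- have -> : quat_tr q1 *: q2 * p1 = q2 * p1 * (q1 + quat_conj q1).
    by rewrite quat_trE -scalerAr mulr1 scalerAl.
  rewrite quat_conjD quat_conjM quat_conjZ quat_conj1.
  rewrite !mulrDr !mulrDl -!scalerAr (mulrA q2 _ p2) quat_normE -!scalerAl.
  by rewrite mul1r mulr1 !scalerA !mulrA; zmod.
Qed.

Lemma octo_octonion :
  quat_disc a b m != 0 -> g != 0 -> octonion_algebra O.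
Proof.
move=> D_neq0 g_neq0.
exists (quat a b m : falgType K), (@quat_conj K a b m), g, id.
split; [exact: quat_quaternion | exact: quat_standard | exact: g_neq0 |].
by split=> //; exists id.
Qed.

(** The Cayley-Dickson generator is orthogonal to xy; adding s e to it makes the
    trace element take the prescribed value s D. *)
Lemma octo_trace (s : K) :
  trace_elt ((quat_x a b m, 0) : O) (quat_y a b m, 0) (s *: quat_e a b m, 1) m
  = (s * quat_disc a b m) *: naone.
Proof.
rewrite /trace_elt octo_mul_quatl mul0r octo_mul_quatl octo_mul_quatr !mul1r.
congr (_, _) => /=.
  rewrite -scalerAr -scalerAl -scalerDr quat_e_trace scalerDr !scalerA.
  by rewrite (mulrC m) addrAC subrr add0r.
rewrite quat_trE scaler0 /quat_x /quat_y mulQE /= -scalerBl.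
by rewrite -[RHS](scale0r (1 : Q)); congr (_ *: _); ring.
Qed.

End OctonionAlgebra.

(** * The Cayley-Dickson relations in an alternative ring *)

Section CayleyDicksonRelations.
Local Open Scope ring_scope.
Variables (R : comNzRingType) (A : naRingType) (i : R -> A).
Hypotheses (altA : alternative A).
Hypotheses (iD : {morph i : k l / k + l}) (i1 : i 1 = naone).
Hypotheses (iM : {morph i : k l / k * l >-> k ** l}).
Hypothesis iC : forall k, in_center (i k).
Implicit Types (k l : R).

Lemma central0 : i 0 = 0.
Proof. by apply: (addrI (i 0)); rewrite -iD !addr0. Qed.
Lemma centralN k : i (- k) = - i k.
Proof. by apply: (addrI (i k)); rewrite -iD !subrr central0. Qed.

Lemma central_comm k (r : A) : r ** i k = i k ** r.
Proof. by have [_ ->] := iC k. Qed.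
Lemma central_mulA k (r s : A) : (i k ** r) ** s = i k ** (r ** s).
Proof. by have [/(_ r s)[h _ _] _] := iC k; rewrite associatorE h addr0. Qed.
Lemma central_mulCA k (r s : A) : r ** (i k ** s) = i k ** (r ** s).
Proof.
have [/(_ r s)[_ h _] _] := iC k.
by rewrite -central_mulA -(central_comm k r) associatorE h addr0.
Qed.
Lemma central_act k l (r : A) : i k ** (i l ** r) = i (k * l) ** r.
Proof. by rewrite iM central_mulA. Qed.

(* [central_act] comes before [central_mulCA], which would loop on nested
   scalars. *)
Definition centralE := (iD, centralN, @namulDl A, @namulDr A, @namulNl A,
  @namulNr A, central_act, central_mulA, central_mulCA).

Variables (x y z : A) (a b c m s t : R).
Local Notation Q := (quat a b m).
Local Notation p := (x ** y).
Implicit Types u v : Q.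
Hypotheses (xx : x ** x = i a) (yy : y ** y = i b) (zz : z ** z = i c).
Hypotheses (xy : x ** y + y ** x = i m).
Hypotheses (xz : x ** z + z ** x = 0) (yz : y ** z + z ** y = 0).
Hypothesis trE : p ** z + z ** p = i m ** z + i t.
Hypothesis stE : s * quat_disc a b m = t.

(** Locked, because unification would otherwise see through it to a sum and
    distribute products over it. *)
Definition quat_embed : Q -> A := locked (fun u : Q =>
  let: (u0, u1, u2, u3) := u in i u0 + i u1 ** x + i u2 ** y + i u3 ** p).
Local Notation theta := quat_embed.

Lemma quat_embedE k0 k1 k2 k3 :
  theta (Quat a b m k0 k1 k2 k3) = i k0 + i k1 ** x + i k2 ** y + i k3 ** p.
Proof. by rewrite /quat_embed -lock. Qed.

Lemma quat_embedD u v : theta (u + v) = theta u + theta v.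
Proof.
have [u0 [u1 [u2 [u3 ->]]]] := quatP u; have [v0 [v1 [v2 [v3 ->]]]] := quatP v.
by rewrite addQE !quat_embedE !centralE; zmod.
Qed.
Lemma quat_embed0 : theta 0 = 0.
Proof. by apply: (addrI (theta 0)); rewrite -quat_embedD !addr0. Qed.
Lemma quat_embedZ k u : theta (k *: u) = i k ** theta u.
Proof.
have [u0 [u1 [u2 [u3 ->]]]] := quatP u.
by rewrite scaleQE !quat_embedE !centralE iM.
Qed.
Lemma quat_embedN u : theta (- u) = - theta u.
Proof. by rewrite -scaleN1r quat_embedZ centralN i1 namulNl namul1r. Qed.
Lemma quat_embed1 : theta 1 = naone.
Proof.
by rewrite oneQE quat_embedE i1 central0 !naring0l !addr0.
Qed.
Lemma quat_embed_scalar k : theta (k%:A) = i k.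
Proof. by rewrite quat_embedZ quat_embed1 namulr1. Qed.

Lemma yxE : y ** x = i m - p. Proof. by rewrite -xy; zmod. Qed.

Lemma quat_embed_mulx u : x ** theta u = theta (quat_x a b m * u).
Proof.
have [u0 [u1 [u2 [u3 ->]]]] := quatP u.
have -> : quat_x a b m * Quat a b m u0 u1 u2 u3 =
    Quat a b m (u1 * a) u0 (u3 * a) u2.
  by rewrite /quat_x mulQE; congr Quat => /=; ring.
have xp : x ** p = i a ** y by rewrite -namul_altl // xx.
rewrite !quat_embedE !centralE xx xp (central_comm _ x) central_act -iM.
by zmod.
Qed.

Lemma quat_embed_muly u : y ** theta u = theta (quat_y a b m * u).
Proof.
have [u0 [u1 [u2 [u3 ->]]]] := quatP u.
have -> : quat_y a b m * Quat a b m u0 u1 u2 u3 =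
    Quat a b m (u1 * m + u2 * b) (- (u3 * b)) (u0 + u3 * m) (- u1).
  by rewrite /quat_y mulQE; congr Quat => /=; ring.
have yp : y ** p = i m ** y - i b ** x.
  by rewrite -namul_flex // yxE namulDl namulNl namul_altr // yy central_comm.
rewrite !quat_embedE !centralE (central_comm _ y) yy yp yxE !centralE -!iM.
by zmod.
Qed.

(** Here (xy)u = x(yu) holds as an instance of Artin's theorem: the image of the
    quaternions lies in the subring generated by x and y. *)
Lemma quat_embed_mulxy u :
  p ** theta u = theta (quat_x a b m * quat_y a b m * u).
Proof.
rewrite -mulrA -quat_embed_mulx -quat_embed_muly associatorE.
suff -> : associator x y (theta u) = 0 by rewrite addr0.
have [u0 [u1 [u2 [u3 ->]]]] := quatP u; rewrite quat_embedE !associatorDr.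
have assoc_act k r : associator x y (i k ** r) = i k ** associator x y r.
  by rewrite /associator !centralE.
have [/(_ x y)[_ _ ->] _] := iC u0; rewrite !assoc_act associatorlr //.
rewrite associatorrr // (associator_cycle altA p).
by rewrite associator_mull // associatorlr // !(naring0l, naring0r) !addr0.
Qed.

Lemma quat_embedM u v : theta (u * v) = theta u ** theta v.
Proof.
have [u0 [u1 [u2 [u3 ->]]]] := quatP u.
have uE : Quat a b m u0 u1 u2 u3 = u0 *: 1 + u1 *: quat_x a b m
    + u2 *: quat_y a b m + u3 *: (quat_x a b m * quat_y a b m).
  rewrite /quat_x /quat_y mulQE oneQE !scaleQE !addQE; congr Quat => /=; ring.
rewrite [in LHS]uE !mulrDl -!scalerAl mul1r !quat_embedD !quat_embedZ.
rewrite -(quat_embed_mulx v) -(quat_embed_muly v) -(quat_embed_mulxy v).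
by rewrite quat_embedE !namulDl !central_mulA.
Qed.

Local Notation tr := (@quat_tr R a b m).

Lemma quat_embed_conj u : theta (quat_conj u) = i (tr u) - theta u.
Proof.
by rewrite quat_conj_tr quat_embedD quat_embedN quat_embed_scalar.
Qed.

Lemma quat_embed_anticomm_z u :
  theta u ** z + z ** theta u = i (tr u) ** z + i (t * u.2).
Proof.
have [u0 [u1 [u2 [u3 ->]]]] := quatP u; rewrite quat_embedE /=.
have zx : z ** x = - (x ** z) by apply: eq_of_sub0; rewrite opprK addrC.
have zy : z ** y = - (y ** z) by apply: eq_of_sub0; rewrite opprK addrC.
have zp : z ** p = i m ** z + i t - p ** z by rewrite -trE; zmod.
rewrite !centralE (central_comm _ z) zx zy zp !centralE.
rewrite -iM (mulrC t) (mulrC m).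
by zmod.
Qed.

Local Notation e := (quat_e a b m).

(** The quaternion component of z is a multiple of e because z is orthogonal to
    1, x and y; what remains of z is orthogonal to all quaternions. *)
Definition cd_generator : A := z - theta (s *: e).
Local Notation w := cd_generator.

Lemma cd_generator_anticomm u : theta u ** w + w ** theta u = i (tr u) ** w.
Proof.
rewrite /cd_generator !namulE -!quat_embedM.
have -> : theta u ** z - theta (u * (s *: e))
    + (z ** theta u - theta (s *: e * u))
  = (theta u ** z + z ** theta u) - theta (u * (s *: e) + s *: e * u).
  by rewrite quat_embedD; zmod.
rewrite quat_embed_anticomm_z -quat_embedZ.
have -> : u * (s *: e) + s *: e * u = (t * u.2)%:A + tr u *: (s *: e).
  have [u0 [u1 [u2 [u3 ->]]]] := quatP u; rewrite -stE /quat_e /quat_disc.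
  rewrite oneQE !scaleQE !mulQE !addQE /=; congr Quat => /=; ring.
by rewrite quat_embedD quat_embed_scalar; zmod.
Qed.

Lemma cd_generator_comm u : theta u ** w = w ** theta (quat_conj u).
Proof.
rewrite quat_embed_conj (namulDr w) namulNr central_comm -cd_generator_anticomm.
by zmod.
Qed.

Lemma cd_generator_commr u : w ** theta u = theta (quat_conj u) ** w.
Proof. by rewrite cd_generator_comm quat_conjK. Qed.

Lemma quat_embed_mul_conj u v :
  theta (u * quat_conj v) = i (tr v) ** theta u - theta (u * v).
Proof.
rewrite quat_conj_tr mulrBr -scalerAr mulr1 quat_embedD quat_embedN.
by rewrite quat_embedZ.
Qed.

Lemma cd_generator_sqr : w ** w = i (c - s * t).
Proof.
rewrite {1}/cd_generator {1}/cd_generator.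
have -> : (z - theta (s *: e)) ** (z - theta (s *: e)) =
    z ** z - (theta (s *: e) ** z + z ** theta (s *: e))
    + theta (s *: e * (s *: e)).
  by rewrite quat_embedM !namulE; zmod.
rewrite zz quat_embed_anticomm_z.
have -> : s *: e * (s *: e) = (s * t)%:A.
  rewrite -stE /quat_e /quat_disc oneQE !scaleQE !mulQE /=.
  by congr Quat => /=; ring.
rewrite quat_embed_scalar.
have -> : tr (s *: e) = 0 by rewrite /quat_e scaleQE /=; ring.
have -> : (s *: e).2 = s *+ 2 by rewrite /quat_e scaleQE /=; ring.
by rewrite central0 naring0l add0r -centralN -!iD; congr i; ring.
Qed.

(** All three Cayley-Dickson rules follow from uw + wu = tr(u) w: this one and
    the next by linearized alternativity, the third by the middle Moufang
    identity. *)
Lemma cd_mul_left u v : theta u ** (theta v ** w) = theta (v * u) ** w.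
Proof.
have := namul_lin_altl altA (theta u) w (theta (quat_conj v)).
rewrite cd_generator_anticomm -cd_generator_comm -quat_embedM.
rewrite cd_generator_commr quat_conjM quat_conjK quat_embed_mul_conj.
rewrite central_mulA -cd_generator_comm namulDl namulNl central_mulA => h.
apply: eq_of_sub0; apply: (addrI (i (tr u) ** (theta v ** w))).
by rewrite addr0 -[RHS]h; zmod.
Qed.

Lemma cd_mul_mid u v : (theta u ** w) ** theta v = theta (u * quat_conj v) ** w.
Proof.
have := namul_lin_altr altA (theta u) w (theta v).
rewrite (addrC (w ** _)) cd_generator_anticomm central_mulCA -quat_embedM.
rewrite quat_embed_mul_conj namulDl namulNl central_mulA => <-.
by zmod.
Qed.

Lemma cd_mul_right u v :
  (theta u ** w) ** (theta v ** w) = i (c - s * t) ** theta (quat_conj v * u).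
Proof.
rewrite (cd_generator_comm u) middle_moufang // -quat_embedM.
rewrite cd_generator_commr quat_conjM quat_conjK namul_altr //.
by rewrite cd_generator_sqr central_comm.
Qed.

Definition cd_embed (q : Q * Q) : A := theta q.1 + theta q.2 ** w.

Lemma cd_embedM q r :
  cd_embed q ** cd_embed r =
  cd_embed (q.1 * r.1 + (c - s * t) *: (quat_conj r.2 * q.2),
            r.2 * q.1 + q.2 * quat_conj r.1).
Proof.
case: q r => [q1 q2] [r1 r2]; rewrite /cd_embed /=.
rewrite (namulDl (theta q1)) (namulDr (theta q1)) (namulDr (theta q2 ** w)).
rewrite -quat_embedM cd_mul_left cd_mul_mid cd_mul_right !quat_embedD.
by rewrite quat_embedZ (namulDl (theta (r2 * q1))); zmod.
Qed.

End CayleyDicksonRelations.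

(** * Bases adapted to a ternary quadratic form *)

Section TernaryForms.
Local Open Scope ring_scope.
Variables (F : fieldType) (V : vectType F) (phi : V -> F).
Hypothesis phi_quad : quadratic_form phi.
Implicit Types (k l : F) (u v w x y z : V).
Local Notation "<( u , v )>" := (polar phi u v) (format "<( u ,  v )>").

Lemma quadZ k v : phi (k *: v) = k ^+ 2 * phi v.
Proof. by case: phi_quad. Qed.
Lemma quadD u v : phi (u + v) = phi u + phi v + <(u, v)>.
Proof. by rewrite /polar; ring. Qed.
Lemma polarC u v : <(u, v)> = <(v, u)>.
Proof. by rewrite /polar (addrC u); ring. Qed.
Lemma polar_linear w : scalar (polar phi ^~ w).
Proof. by case: phi_quad. Qed.
Lemma polarDl u v w : <(u + v, w)> = <(u, w)> + <(v, w)>.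
Proof. by have := polar_linear w 1 u v; rewrite scale1r mul1r. Qed.
Lemma polar0l w : <(0, w)> = 0.
Proof. by apply: (addrI <(0, w)>); rewrite -polarDl !addr0. Qed.
Lemma polarZl k v w : <(k *: v, w)> = k * <(v, w)>.
Proof. by have := polar_linear w k v 0; rewrite addr0 polar0l addr0. Qed.
Lemma polarDr u v w : <(w, u + v)> = <(w, u)> + <(w, v)>.
Proof. by rewrite !(polarC w) polarDl. Qed.
Lemma polarZr k v w : <(w, k *: v)> = k * <(w, v)>.
Proof. by rewrite !(polarC w) polarZl. Qed.
Lemma quad0 : phi 0 = 0.
Proof. by rewrite -(scale0r 0) quadZ expr0n mul0r. Qed.
Lemma polarvv v : <(v, v)> = phi v *+ 2.
Proof.
have -> : <(v, v)> = phi (2%:R *: v) - phi v *+ 2.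
  by rewrite /polar scaler_nat mulr2n; ring.
by rewrite quadZ; ring.
Qed.

Lemma quad_comb3 x y z k1 k2 k3 :
  <(x, z)> = 0 -> <(y, z)> = 0 ->
  phi (k1 *: x + k2 *: y + k3 *: z) =
  phi x * k1 ^+ 2 + phi y * k2 ^+ 2 + phi z * k3 ^+ 2 + <(x, y)> * k1 * k2.
Proof.
move=> xz yz; rewrite !quadD !quadZ !polarDl !polarZl !polarZr xz yz; ring.
Qed.

Hypothesis phi_nondeg : nondegenerate_quadratic phi.
Hypothesis dimV : \dim {:V} = 3%N.

Lemma nondeg_polar v : (2%:R : F) != 0 -> (forall w, <(v, w)> = 0) -> v = 0.
Proof.
move=> two_neq0 v_rad; case: phi_nondeg => rad [radP _ rad_aniso].
apply/eqP; apply: contraT => v_neq0.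
have := rad_aniso v ((radP v).2 v_rad) v_neq0.
have := v_rad v; rewrite polarvv -mulr_natr => /eqP.
by rewrite mulf_eq0 (negPf two_neq0) orbF => ->.
Qed.

Lemma polar_nonzero : exists x y, <(x, y)> != 0.
Proof.
apply: contrapT => no_xy; case: phi_nondeg => rad [radP].
suff -> : rad = fullv by rewrite dimV.
apply/eqP; rewrite eqEsubv subvf; apply/subvP => v _; apply/radP => w.
by apply/eqP; apply: contraT => vw; case: no_xy; exists v, w.
Qed.

Lemma exists_outside (s : seq V) :
  (size s < 3)%N -> exists v, v \notin <<s>>%VS.
Proof.
move=> s_lt3; apply: contrapT => no_v.
have : (\dim {:V} <= \dim <<s>>)%N.
  apply: dimvS; apply/subvP => v _; apply: contraT => vs.
  by case: no_v; exists v.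
rewrite dimV => /leq_trans/(_ (dim_span s)).
by rewrite leqNgt s_lt3.
Qed.

Lemma basis_triple x y z : x != 0 -> y \notin <[x]>%VS ->
  z \notin <<[:: x; y]>>%VS -> basis_of fullv [:: x; y; z].
Proof.
move=> x_neq0 y_out z_out.
rewrite (perm_basis (Y := [:: z; x; y])); last first.
  by rewrite -(cat1s z) -[[:: x; y; z]]/([:: x; y] ++ [:: z]) perm_catC.
rewrite basisEfree subvf dimV /= andbT free_cons z_out /=.
rewrite (perm_free (Y := [:: y; x])); last first.
  by rewrite -(cat1s x) -(cat1s y) perm_catC.
by rewrite free_cons span_seq1 y_out seq1_free.
Qed.

Lemma basis_coord3 x y z : basis_of fullv [:: x; y; z] ->
  forall v, v = coord [tuple x; y; z] 0 v *: x + coord [tuple x; y; z] 1 v *: y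
                + coord [tuple x; y; z] 2%:R v *: z.
Proof.
move=> xyz_basis v; have v_in : v \in fullv by exact: memvf.
rewrite {1}(coord_basis (X := [tuple x; y; z]) xyz_basis v_in).
rewrite !big_ord_recl big_ord0 addr0 addrA.
by congr (_ *: _ + _ *: _ + _ *: _); congr (coord _ _ _); apply: val_inj.
Qed.

(** Outside characteristic 2 nondegeneracy makes the polar form have zero
    radical, and orthogonalization never meets an isotropic complement. In
    characteristic 2 the polar form is alternating; it is nonzero since its
    radical is at most a line, and subtracting from a third vector its component
    in the plane of a nonorthogonal pair gives z. *)
Lemma adapted_basis : exists x y z,
  [/\ basis_of fullv [:: x; y; z], <(x, z)> = 0, <(y, z)> = 0,
      quat_disc (phi x) (phi y) <(x, y)> != 0
    & [/\ (2%:R : F) != 0, phi x != 0, phi y != 0 & phi z != 0] \/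
      (2%:R : F) = 0 /\ <(x, y)> != 0].
Proof.
have span_mem (x y v : V) k l :
    v + (k *: x + l *: y) \in <<[:: x; y]>>%VS -> v \in <<[:: x; y]>>%VS.
  move=> h; rewrite -[v](addrK (k *: x + l *: y)) rpredB // rpredD //.
    by rewrite rpredZ ?memv_span ?mem_head.
  by rewrite rpredZ ?memv_span // !inE eqxx orbT.
have [two0|two_neq0] := eqVneq (2%:R : F) 0.
  have add2 k : k + k = 0 by rewrite -mulr2n -mulr_natr two0 mulr0.
  have polar_alt v : <(v, v)> = 0 by rewrite polarvv mulr2n add2.
  have [x [y xy]] := polar_nonzero.
  have [//|v v_out] := @exists_outside [:: x; y].
  pose z := v + ((<(v, y)> / <(x, y)>) *: x + (<(v, x)> / <(x, y)>) *: y).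
  exists x, y, z; split.
  - apply: basis_triple; first by apply: contraNneq xy => ->; rewrite polar0l.
      apply: contra xy => /vlineP[k ->].
      by rewrite polarZr polar_alt mulr0.
    by apply: contra v_out; exact: span_mem.
  - rewrite /z !polarDr !polarZr polar_alt (polarC x v) mulr0 add0r.
    by rewrite divfK // add2.
  - rewrite /z !polarDr !polarZr polar_alt (polarC y v) (polarC y x) mulr0.
    by rewrite addr0 divfK // add2.
  - have four0 : (4%:R : F) = 0 by rewrite -[4%N]/(2 * 2)%N natrM two0 mulr0.
    by rewrite /quat_disc -mulr_natr four0 mulr0 subr0 expf_neq0.
  - by right.
have [x ax] : exists x, phi x != 0.
  apply: contrapT => no_x; have phi0 u : phi u = 0.
    by apply/eqP; apply: contraT => u_neq0; case: no_x; exists u.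
  have [u [v]] := polar_nonzero; case/eqP.
  by rewrite /polar !phi0 !subr0.
have pvv u : phi u != 0 -> <(u, u)> != 0.
  by move=> u0; rewrite polarvv -mulr_natr mulf_neq0.
have x_neq0 : x != 0 by apply: contraNneq ax => ->; rewrite quad0.
have orth u v : phi u != 0 -> <(u, v - (<(u, v)> / <(u, u)>) *: u)> = 0.
  move=> u0; rewrite -scaleNr polarDr polarZr mulNr divfK ?subrr //.
  exact: pvv.
have [y [xy bx]] : exists y, <(x, y)> = 0 /\ phi y != 0.
  apply: contrapT => no_y; have phi0 y : <(x, y)> = 0 -> phi y = 0.
    by move=> xy; apply/eqP; apply: contraT => y0; case: no_y; exists y.
  have [//|v v_out] := @exists_outside [:: x].
  have := orth x v ax; set y := v - _ => xy.
  suff y0 : y = 0.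
    move: v_out; rewrite span_seq1 => /negP[]; apply/vlineP.
    by exists (<(x, v)> / <(x, x)>); apply/eqP; rewrite -subr_eq0 -/y y0.
  apply: nondeg_polar => // w.
  rewrite -[w](subrK ((<(x, w)> / <(x, x)>) *: x)) polarDr polarZr.
  rewrite (polarC y x) xy mulr0 addr0; have xw := orth x w ax.
  by rewrite /polar (phi0 _ xy) (phi0 _ xw) phi0 ?subr0 // polarDr xy xw addr0.
have y_out : y \notin <[x]>%VS.
  apply/negP => /vlineP[k ykx]; case/eqP: bx; move/eqP: xy.
  rewrite ykx polarZr mulf_eq0 (negPf (pvv _ ax)) orbF => /eqP ->.
  by rewrite scale0r quad0.
have [//|v v_out] := @exists_outside [:: x; y].
pose z := v + (- (<(x, v)> / <(x, x)>) *: x + - (<(y, v)> / <(y, y)>) *: y).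
have xz : <(x, z)> = 0.
  by rewrite /z !polarDr !polarZr xy mulr0 addr0 mulNr divfK ?subrr // pvv.
have yz : <(y, z)> = 0.
  rewrite /z !polarDr !polarZr (polarC y x) xy mulr0 add0r mulNr.
  by rewrite divfK ?subrr // pvv.
have z_out : z \notin <<[:: x; y]>>%VS by apply: contra v_out; exact: span_mem.
have xyz_basis := basis_triple x_neq0 y_out z_out.
exists x, y, z; split=> //.
  rewrite /quat_disc xy expr0n sub0r oppr_eq0 -mulr_natr !mulf_neq0 //.
  by rewrite -[4%N]/(2 * 2)%N natrM mulf_neq0.
left; split=> //; apply: contraNneq z_out => cz.
suff -> : z = 0 by rewrite mem0v.
apply: nondeg_polar => // w; rewrite (basis_coord3 xyz_basis w).
rewrite !polarDr !polarZr (polarC z x) (polarC z y) xz yz polarvv cz.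
by rewrite mul0rn !mulr0 !addr0.
Qed.

End TernaryForms.

(** * Restriction of scalars *)

Section RestrictionOfScalars.
Local Open Scope ring_scope.

(** The universal property concerns algebras over the field of the quadratic
    form, while the octonion algebra lives over a larger field. *)
Definition restr_scalars (F K : fieldType) (f : {rmorphism F -> K})
  (L : naAlgType K) : Type := L.

Variables (F K : fieldType) (f : {rmorphism F -> K}) (L : naAlgType K).
Local Notation LF := (restr_scalars f L).

HB.instance Definition _ := NaRing.copy LF L.

Definition restr_scale (k : F) (u : LF) : LF := f k *: (u : L).

Lemma restr_scaleA k l u :
  restr_scale k (restr_scale l u) = restr_scale (k * l) u.
Proof. by rewrite /restr_scale scalerA rmorphM. Qed.
Lemma restr_scale1 : left_id 1 restr_scale.
Proof. by move=> u; rewrite /restr_scale rmorph1 scale1r. Qed.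
Lemma restr_scaleDr : right_distributive restr_scale +%R.
Proof. by move=> k u v; apply: scalerDr. Qed.
Lemma restr_scaleDl u : {morph restr_scale^~ u : k l / k + l}.
Proof. by move=> k l; rewrite /restr_scale rmorphD scalerDl. Qed.

HB.instance Definition _ := GRing.Zmodule_isLmodule.Build F LF
  restr_scaleA restr_scale1 restr_scaleDr restr_scaleDl.

Lemma restr_scaleAl k (u v : LF) : k *: (u ** v) = (k *: u) ** v.
Proof. exact: (nascaleAl (f k) (u : L) v). Qed.
Lemma restr_scaleAr k (u v : LF) : k *: (u ** v) = u ** (k *: v).
Proof. exact: (nascaleAr (f k) (u : L) v). Qed.

HB.instance Definition _ :=
  NaRing_isNaAlg.Build F LF restr_scaleAl restr_scaleAr.

End RestrictionOfScalars.

(** * Evaluation of polynomials at a central element *)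

Section PolynomialEvaluation.
Local Open Scope ring_scope.
Variables (F : fieldType) (A : naAlgType F) (t : A).
Implicit Types (p q : {poly F}) (k : F).

Definition napow n : A := iter n (namul t) naone.
Definition naeval p : A := \sum_(j < size p) p`_j *: napow j.

Lemma naeval_wide n p : (size p <= n)%N ->
  naeval p = \sum_(j < n) p`_j *: napow j.
Proof.
move=> p_n; rewrite /naeval (big_ord_widen n (fun j => p`_j *: napow j)) //.
rewrite big_mkcond; apply: eq_bigr => j _.
by case: ltnP => // ?; rewrite nth_default ?scale0r.
Qed.

Lemma naeval_linear : linear naeval.
Proof.
move=> k p q; pose n := maxn (size p) (size q).
have p_n : (size p <= n)%N by rewrite leq_maxl.
have q_n : (size q <= n)%N by rewrite leq_maxr.
have pq_n : (size (k *: p + q)%R <= n)%N.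
  rewrite (leq_trans (size_polyD _ _)) // geq_max q_n.
  by rewrite (leq_trans (size_scale_leq _ _)).
rewrite !(naeval_wide (n := n)) // scaler_sumr -big_split /=.
by apply: eq_bigr => j _; rewrite coefD coefZ scalerDl scalerA.
Qed.
Lemma naevalD : {morph naeval : p q / p + q}.
Proof. by move=> p q; rewrite -[p]scale1r naeval_linear !scale1r. Qed.
Lemma naevalZ k p : naeval (k *: p) = k *: naeval p.
Proof.
have /(addrI (naeval 0)) h0 : naeval 0 + naeval 0 = naeval 0 + 0.
  by rewrite -naevalD !addr0.
by rewrite -[k *: p]addr0 naeval_linear h0 addr0.
Qed.
Lemma naevalC k : naeval k%:P = k *: naone.
Proof.
by rewrite (naeval_wide (n := 1)) ?size_polyC_leq1 // big_ord1 coefC.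
Qed.
Lemma naeval1 : naeval 1 = naone.
Proof. by rewrite naevalC scale1r. Qed.
Lemma naevalXM p : naeval ('X * p) = t ** naeval p.
Proof.
have pX : (size ('X * p)%R <= (size p).+1)%N.
  by rewrite (leq_trans (size_polyMleq _ _)) // size_polyX.
rewrite (naeval_wide pX) big_ord_recl coefXM scale0r add0r /naeval.
have tsum (I : finType) (E : I -> A) : t ** (\sum_j E j) = \sum_j t ** E j.
  apply: (big_morph (namul t)); first exact: namulDr.
  by apply: (addrI (t ** 0)); rewrite -namulDr !addr0.
by rewrite tsum; apply: eq_bigr => j _; rewrite coefXM /= nascaleAr.
Qed.
Lemma naevalX : naeval 'X = t.
Proof. by rewrite -['X]mulr1 naevalXM naeval1 namulr1. Qed.

Hypothesis t_central : in_center t.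

Lemma central_scalar k : in_center (k *: naone : A).
Proof.
split=> [r s|r]; last by rewrite -nascaleAl -nascaleAr namul1r namulr1.
by split; rewrite /associator -?nascaleAl -?nascaleAr -?nascaleAl -?nascaleAr
   ?namul1r ?namulr1 -?nascaleAl ?namul1r subrr.
Qed.

Lemma centralD (r s : A) : in_center r -> in_center s -> in_center (r + s).
Proof.
move=> [rA rC] [sA sC]; split=> [u v|u]; last by rewrite namulDl namulDr rC sC.
have [r1 r2 r3] := rA u v; have [s1 s2 s3] := sA u v.
by rewrite associatorDl associatorDm associatorDr r1 r2 r3 s1 s2 s3 addr0.
Qed.

Lemma centralM (r : A) : in_center r -> in_center (t ** r).
Proof.
case: t_central => [tA tC] [rA rC].
have tm u v : t ** (u ** v) = (t ** u) ** v.
  by rewrite associatorE; case: (tA u v) => -> _ _; rewrite addr0.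
have mt u v : (u ** t) ** v = u ** (t ** v).
  by rewrite associatorE; case: (tA u v) => _ -> _; rewrite addr0.
have rm u v : r ** (u ** v) = (r ** u) ** v.
  by rewrite associatorE; case: (rA u v) => -> _ _; rewrite addr0.
have mr u v : (u ** r) ** v = u ** (r ** v).
  by rewrite associatorE; case: (rA u v) => _ -> _; rewrite addr0.
have ut u v : u ** (t ** v) = t ** (u ** v) by rewrite -mt -tC tm.
have ur u v : u ** (r ** v) = r ** (u ** v) by rewrite -mr -rC rm.
split=> [u v|u]; last by rewrite -tm rC ut.
split; apply/eqP; rewrite subr_eq0; apply/eqP.
- by rewrite -!tm -rm.
- by rewrite (ut u r) -!tm mr (ut u).
- by rewrite (ut _ r) (ut v r) (ut u) -(rC v) ur rC.
Qed.

Lemma naeval_central p : in_center (naeval p).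
Proof.
elim/poly_ind: p => [|p k IHp].
  by rewrite -[0]/(0%:P) naevalC; exact: central_scalar.
rewrite naevalD naevalC commr_polyX naevalXM.
by apply: centralD; [exact: centralM | exact: central_scalar].
Qed.

Lemma naevalM : {morph naeval : p q / p * q >-> p ** q}.
Proof.
move=> p q; elim/poly_ind: p => [|p k IHp].
  by rewrite mul0r -[0]/(0%:P) naevalC scale0r naring0l.
rewrite mulrDl !naevalD commr_polyX -mulrA !naevalXM IHp namulDl mul_polyC.
rewrite naevalZ naevalC -nascaleAl namul1r associatorE.
by have [/(_ (naeval p) (naeval q))[-> _ _] _] := t_central; rewrite addr0.
Qed.

End PolynomialEvaluation.

Section EvaluationMorphism.
Local Open Scope ring_scope.
Variables (F K : fieldType) (f : {rmorphism {poly F} -> K}).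
Variables (A : naAlgType F) (L : naAlgType K) (G : A -> L) (t : A).
Hypotheses (GD : {morph G : u v / u + v}) (G1 : G naone = naone).
Hypothesis GM : {morph G : u v / u ** v}.
Hypothesis GZ : forall k u, G (k *: u) = f k%:P *: G u.
Hypothesis Gt : G t = f 'X *: naone.

Lemma naeval_morph p : G (naeval t p) = f p *: naone.
Proof.
elim/poly_ind: p => [|p k IHp].
  by rewrite -[0]/(0%:P) naevalC GZ rmorph0 !scale0r.
rewrite (mulrC p) naevalD naevalXM naevalC GD GM GZ G1 IHp Gt.
by rewrite rmorphD rmorphM scalerDl nascalarM.
Qed.

End EvaluationMorphism.

(** * Denominators in a field of fractions *)

Section FractionField.
Local Open Scope ring_scope.
Local Open Scope quotient_scope.
Local Notation tofrac := (@FracField.tofrac _).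

Lemma fraction_repr (R : idomainType) (k : {fraction R}) :
  exists n d, d != 0 /\ k = (tofrac d)^-1 * tofrac n.
Proof.
elim/quotW: k => r; exists (\n_r), (\d_r); split; first exact: denom_ratioP.
apply: (canRL (mulKf _)); first by rewrite tofrac_eq0 denom_ratioP.
unlock FracField.tofrac; rewrite -[LHS]FracField.pi_mul.
apply/eqmodP; rewrite /= FracField.equivfE /FracField.mulf.
by rewrite !numden_Ratio ?(oner_neq0, mul1r, mulr1, denom_ratioP) // mulrC.
Qed.

Lemma fraction_common_denom (R : idomainType) (s : seq {fraction R}) :
  exists2 d, d != 0
    & forall k, k \in s -> exists n, k = (tofrac d)^-1 * tofrac n.
Proof.
elim: s => [|k s [d d0 IHs]]; first by exists 1; rewrite ?oner_neq0.
have [n [e [e0 ->]]] := fraction_repr k.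
exists (e * d); first by rewrite mulf_neq0.
have [te0 td0] : tofrac e != 0 /\ tofrac d != 0 by rewrite !tofrac_eq0.
move=> l; rewrite inE => /predU1P[->|/IHs[n' ->]].
  by exists (d * n); rewrite !tofracM invfM -mulrA mulKf.
by exists (e * n'); rewrite (mulrC e d) !tofracM invfM -mulrA mulKf.
Qed.

End FractionField.

(** * Generators of the alternative Clifford algebra *)

Section CliffordInduction.
Local Open Scope ring_scope.
Local Open Scope quotient_scope.
Variables (F : fieldType) (V : vectType F) (phi : V -> F).
Local Notation C := (altClifford phi).

Lemma altClifford_ind (P : C -> Prop) :
  P naone -> (forall k u v, P u -> P v -> P (k *: u + v)) ->
  (forall u v, P u -> P v -> P (u ** v)) ->
  (forall v, P (cliffordGen phi v)) ->
  forall u, P u.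
Proof.
move=> P1 PD PM Pgen; elim/quotW.
have P0 : P 0 by rewrite -(addNr naone) -scaleN1r; apply: PD.
have PZ k u : P u -> P (k *: u).
  by move=> Pu; rewrite -[k *: u]addr0; apply: PD.
elim=> [v|||s Ps|s Ps t Pt|k s Ps|s Ps t Pt].
- exact: Pgen.
- by rewrite pi_TZero.
- by rewrite pi_TOne.
- by rewrite pi_TOpp -scaleN1r; apply: PZ.
- by rewrite pi_TAdd -[X in X + _]scale1r; apply: PD.
- by rewrite pi_TScale; apply: PZ.
by rewrite pi_TMul; apply: PM.
Qed.

Lemma cliffordGenD (u v : V) :
  cliffordGen phi (u + v) = cliffordGen phi u + cliffordGen phi v.
Proof. by rewrite -[u]scale1r cliffordGen_linear !scale1r. Qed.

Lemma cliffordGenZ k (v : V) :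
  cliffordGen phi (k *: v) = k *: cliffordGen phi v.
Proof.
have /(addrI (cliffordGen phi 0)) gen0 :
    cliffordGen phi 0 + cliffordGen phi 0 = cliffordGen phi 0 + 0.
  by rewrite -cliffordGenD !addr0.
by rewrite -[k *: v]addr0 cliffordGen_linear gen0 addr0.
Qed.

Lemma cliffordGen_anticomm (u v : V) :
  cliffordGen phi u ** cliffordGen phi v
    + cliffordGen phi v ** cliffordGen phi u
  = polar phi u v *: naone.
Proof.
have := cliffordGen_sqr phi (u + v).
rewrite cliffordGenD namulDl !namulDr !cliffordGen_sqr => uv.
by rewrite /polar !scalerBl -uv; zmod.
Qed.

End CliffordInduction.

(** * Centrality of the trace element *)

Section TernaryClifford.
Local Open Scope ring_scope.
Variables (F : fieldType) (V : vectType F) (phi : V -> F) (x y z : V).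
Hypotheses (phi_quad : quadratic_form phi).
Hypothesis (xyz_basis : basis_of fullv [:: x; y; z]).
Hypotheses (xz0 : polar phi x z = 0) (yz0 : polar phi y z = 0).
Local Notation a := (phi x).
Local Notation b := (phi y).
Local Notation c := (phi z).
Local Notation m := (polar phi x y).
Local Notation D := (quat_disc a b m).
Hypothesis (D_neq0 : D != 0).
Hypothesis charF : [/\ (2%:R : F) != 0, a != 0, b != 0 & c != 0] \/
      (2%:R : F) = 0 /\ m != 0.
Local Notation C := (altClifford phi).
Local Notation cx := (cliffordGen phi x : C).
Local Notation cy := (cliffordGen phi y : C).
Local Notation cz := (cliffordGen phi z : C).

Let altC : alternative C := @altClifford_alternative F V phi.
Let sqr_x : cx ** cx = a *: naone := cliffordGen_sqr phi x.
Let sqr_y : cy ** cy = b *: naone := cliffordGen_sqr phi y.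
Let sqr_z : cz ** cz = c *: naone := cliffordGen_sqr phi z.
Let anti_xy : cx ** cy + cy ** cx = m *: naone := cliffordGen_anticomm phi x y.
Let anti_xz : cx ** cz + cz ** cx = 0.
Proof. by rewrite cliffordGen_anticomm xz0 scale0r. Qed.
Let anti_yz : cy ** cz + cz ** cy = 0.
Proof. by rewrite cliffordGen_anticomm yz0 scale0r. Qed.

Definition clifford_trace : C := trace_elt cx cy cz m.
Local Notation T := clifford_trace.

Let co j v : F := coord [tuple x; y; z] j v.

Lemma cliffordGen_coord v : cliffordGen phi v =
  co 0 v *: cx + co 1 v *: cy + co 2%:R v *: cz.
Proof.
by rewrite {1}(basis_coord3 xyz_basis v) !cliffordGenD !cliffordGenZ.
Qed.

Lemma clifford_trace_associates u : associates_with T u.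
Proof.
have [Tx Ty Tz] := trace_elt_associates altC sqr_x sqr_y sqr_z anti_xy anti_xz
  anti_yz charF.
have TD r s : associates_with T r -> associates_with T s ->
    associates_with T (r + s).
  by move=> Tr Ts w; rewrite associatorDm Tr Ts addr0.
have TZ k r : associates_with T r -> associates_with T (k *: r).
  move=> Tr w; rewrite /associator -nascaleAr -!nascaleAl -nascaleAr -scalerBr.
  by rewrite -/(associator T r w) Tr scaler0.
elim/altClifford_ind: u => [w|k u v Tu Tv|u v Tu Tv|v].
- by rewrite /associator namulr1 namul1r subrr.
- by apply: (TD _ _ _ Tv); apply: TZ.
- exact: associates_withM.
rewrite cliffordGen_coord; apply: (TD _ _ _ (TZ _ _ Tz)).
by apply: TD; apply: TZ.
Qed.

(** An element of the nucleus that commutes with generators commutes with their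
    products. *)
Lemma clifford_trace_central : in_center T.
Proof.
have Tass1 r s : associator T r s = 0 by exact: clifford_trace_associates.
have Tass2 r s : associator r T s = 0 by rewrite associatorCl // Tass1 oppr0.
have Tass3 r s : associator r s T = 0 by rewrite associator_cycle.
split=> [r s|]; first by split.
elim/altClifford_ind=> [|k u v Tu Tv|u v Tu Tv|v].
- by rewrite namul1r namulr1.
- by rewrite (namulDr T) (namulDl (k *: u)) -nascaleAr -nascaleAl Tu Tv.
- rewrite -[LHS]addr0 -(Tass1 u v) -associatorE Tu associatorE Tass2 addr0 Tv.
  by rewrite -[LHS]addr0 -(Tass3 u v) -associatorE.
move: (trace_elt_commx altC sqr_x anti_xy anti_xz anti_yz).
move: (trace_elt_commy altC sqr_y anti_xy anti_xz anti_yz).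
move: (trace_elt_commz altC cx cy m sqr_z); rewrite -/T.
move: T => t tz ty tx; rewrite cliffordGen_coord !namulDr !namulDl.
by rewrite -!nascaleAr -!nascaleAl tx ty tz.
Qed.

(** * The Clifford algebra as a Cayley-Dickson double over polynomials *)

Definition clifford_scalar : {poly F} -> C := naeval T.
Local Notation iota := clifford_scalar.

Let iD : {morph iota : k l / k + l} := @naevalD F C T.
Let i1 : iota 1 = naone := naeval1 T.
Let iM : {morph iota : k l / k * l >-> k ** l} :=
  naevalM clifford_trace_central.
Let iC : forall k, in_center (iota k) := naeval_central clifford_trace_central.
Let iconst k : iota k%:P = k *: naone := naevalC T k.

(** The coefficient of e in the quaternion component of z, which produces the
    trace s D = t. *)
Definition split_coef : {poly F} := (D^-1)%:P * 'X.
Local Notation s := split_coef.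
Local Notation g := (c%:P - s * 'X).

Lemma split_coefE : s * quat_disc a%:P b%:P m%:P = 'X.
Proof.
have -> : quat_disc a%:P b%:P m%:P = D%:P.
  by rewrite /quat_disc -polyC_exp -polyCM -polyCMn -polyCB.
by rewrite /split_coef mulrAC -polyCM mulVf // mul1r.
Qed.

Let psqr_x : cx ** cx = iota a%:P. Proof. by rewrite iconst. Qed.
Let psqr_y : cy ** cy = iota b%:P. Proof. by rewrite iconst. Qed.
Let psqr_z : cz ** cz = iota c%:P. Proof. by rewrite iconst. Qed.
Let panti_xy : cx ** cy + cy ** cx = iota m%:P. Proof. by rewrite iconst. Qed.
Let ptrace : cx ** cy ** cz + cz ** (cx ** cy) = iota m%:P ** cz + iota 'X.
Proof.
rewrite iconst /clifford_scalar naevalX -nascaleAl namul1r.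
by rewrite /clifford_trace /trace_elt; zmod.
Qed.

Local Notation QR := (quat a%:P b%:P m%:P).
Definition clifford_of_pair : QR * QR -> C := cd_embed iota cx cy cz s.
Local Notation Theta := clifford_of_pair.
Local Notation theta := (@quat_embed _ _ iota cx cy a%:P b%:P m%:P).
Local Notation w := (cd_generator iota cx cy cz a%:P b%:P m%:P s).

Lemma clifford_of_pairE q : Theta q = theta q.1 + theta q.2 ** w.
Proof. by []. Qed.

Lemma quat_embed_x : theta (quat_x _ _ _) = cx.
Proof.
by rewrite quat_embedE i1 (central0 iD) !naring0l namul1r !addr0 add0r.
Qed.
Lemma quat_embed_y : theta (quat_y _ _ _) = cy.
Proof.
by rewrite quat_embedE i1 (central0 iD) !naring0l namul1r !addr0 add0r.
Qed.

(** The image contains the generators, z being (s e) + w, and is closed under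
    products by the Cayley-Dickson relations. *)
Lemma clifford_of_pair_surj u : exists q, u = Theta q.
Proof.
have comb k u1 u2 : (exists q, u1 = Theta q) -> (exists q, u2 = Theta q) ->
    exists q, k *: u1 + u2 = Theta q.
  move=> [q ->] [r ->]; exists (k%:P *: q.1 + r.1, k%:P *: q.2 + r.2).
  rewrite !clifford_of_pairE /= !(quat_embedD iD) !(quat_embedZ iM iC) iconst.
  rewrite -!nascaleAl !namul1r namulDl -nascaleAl scalerDr.
  by zmod.
have zero : exists q, 0 = Theta q.
  exists (0, 0); rewrite clifford_of_pairE /= (quat_embed0 iD) naring0l.
  by rewrite addr0.
elim/altClifford_ind: u => [|k u1 u2|u1 u2 [q ->] [r ->]|v].
- exists (1, 0); rewrite clifford_of_pairE /= (quat_embed0 iD) naring0l addr0.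
  by rewrite (quat_embed1 iD i1).
- exact: comb.
- by rewrite (cd_embedM altC iD i1 iM iC psqr_x psqr_y psqr_z panti_xy anti_xz
    anti_yz ptrace split_coefE); eexists.
rewrite cliffordGen_coord -addrA; apply: (comb).
  exists (quat_x _ _ _, 0); rewrite clifford_of_pairE /= quat_embed_x.
  by rewrite (quat_embed0 iD) naring0l addr0.
apply: (comb).
  exists (quat_y _ _ _, 0); rewrite clifford_of_pairE /= quat_embed_y.
  by rewrite (quat_embed0 iD) naring0l addr0.
rewrite -[X in exists q, X = _]addr0; apply: (comb) => //.
exists (s *: quat_e _ _ _, 1); rewrite clifford_of_pairE /= (quat_embed1 iD i1).
by rewrite namul1r /cd_generator addrC subrK.
Qed.

(** * The octonion algebra over the field of rational functions *)

Local Notation K := {fraction {poly F}}.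
Local Notation tau := (@FracField.tofrac {poly F}).
Definition const_frac : {rmorphism F -> K} := tau \o polyC.
Local Notation rho := const_frac.

Local Notation O := (octo (tau a%:P) (tau b%:P) (tau m%:P) (tau g)).
Local Notation OF := (restr_scalars rho O).
Local Notation QK := (quat (tau a%:P) (tau b%:P) (tau m%:P)).

Definition octo_x : O := (quat_x _ _ _, 0).
Definition octo_y : O := (quat_y _ _ _, 0).
Definition octo_z : O := (tau s *: quat_e _ _ _, 1).

Definition octo_gen (v : V) : OF :=
  co 0 v *: (octo_x : OF) + co 1 v *: (octo_y : OF)
  + co 2%:R v *: (octo_z : OF).

Lemma coord_comb_linear (U : lmodType F) (u1 u2 u3 : U) :
  linear (fun v => co 0 v *: u1 + co 1 v *: u2 + co 2%:R v *: u3).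
Proof.
move=> k u v; have coD j : co j (k *: u + v) = k * co j u + co j v.
  by rewrite /co linearP.
by rewrite !coD !scalerDl -!scalerA !scalerDr; zmod.
Qed.

Lemma octo_gen_linear : linear octo_gen.
Proof. exact: coord_comb_linear. Qed.

Lemma octo_genE v : octo_gen v =
  (Quat _ _ _ (- (tau m%:P * tau s * rho (co 2%:R v))) (rho (co 0 v))
     (rho (co 1 v)) (tau s * rho (co 2%:R v) *+ 2),
   (rho (co 2%:R v))%:A) :> O.
Proof.
have -> : octo_gen v =
  (rho (co 0 v) *: quat_x _ _ _ + rho (co 1 v) *: quat_y _ _ _
     + rho (co 2%:R v) *: (tau s *: quat_e _ _ _),
   rho (co 0 v) *: 0 + rho (co 1 v) *: 0 + (rho (co 2%:R v))%:A) :> O by [].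
rewrite !scaler0 !add0r; congr (_, _).
rewrite /quat_x /quat_y /quat_e [tau s *: _]scaleQE !scaleQE !addQE.
by congr Quat => /=; ring.
Qed.

Lemma tau_disc : tau s * quat_disc (tau a%:P) (tau b%:P) (tau m%:P) = tau 'X.
Proof.
rewrite -split_coefE /quat_disc -rmorphXn -[tau a%:P * _]rmorphM -rmorphMn.
by rewrite -rmorphB -rmorphM.
Qed.

Lemma tau_param : tau g =
  tau c%:P - tau s * (tau s * quat_disc (tau a%:P) (tau b%:P) (tau m%:P)).
Proof. by rewrite tau_disc -rmorphM -rmorphB. Qed.

Lemma octo_gen_sqr v : octo_gen v ** octo_gen v = phi v *: naone.
Proof.
transitivity (rho (phi v) *: (naone : O)); last by [].
have -> : octo_gen v ** octo_gen v = (octo_gen v : O) ** (octo_gen v : O) by [].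
rewrite octo_genE octo_sqr; congr (_, _).
  have -> : rho (phi v) =
      tau a%:P * rho (co 0 v) ^+ 2 + tau b%:P * rho (co 1 v) ^+ 2
      + tau c%:P * rho (co 2%:R v) ^+ 2
      + tau m%:P * rho (co 0 v) * rho (co 1 v).
    have vE : v = co 0 v *: x + co 1 v *: y + co 2%:R v *: z.
      exact: basis_coord3.
    rewrite {1}vE quad_comb3 //.
    move: a b c m (co 0 v) (co 1 v) (co 2%:R v) => a' b' c' m' k0 k1 k2.
    by rewrite !(rmorphXn, rmorphD, rmorphM).
  rewrite (oneQE (tau a%:P)) !scaleQE mulQE addQE tau_param /quat_disc.
  by congr Quat => /=; ring.
rewrite scaler0 -[RHS](scale0r ((rho (co 2%:R v))%:A : QK)).
by congr (_ *: _) => /=; ring.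
Qed.

Let coP (j k : 'I_3) : co j [tuple x; y; z]`_k = (k == j)%:R.
Proof. by apply: coord_free; case/andP: xyz_basis. Qed.

Lemma octo_gen_x : octo_gen x = octo_x.
Proof.
rewrite /octo_gen (coP 0 0) (coP 1 0) (coP 2%:R 0) /= scale1r !scale0r !addr0.
by [].
Qed.
Lemma octo_gen_y : octo_gen y = octo_y.
Proof.
rewrite /octo_gen (coP 0 1) (coP 1 1) (coP 2%:R 1) /= scale1r !scale0r addr0.
by rewrite add0r.
Qed.
Lemma octo_gen_z : octo_gen z = octo_z.
Proof.
rewrite /octo_gen (coP 0 2%:R) (coP 1 2%:R) (coP 2%:R 2%:R) /= scale1r !scale0r.
by rewrite !add0r.
Qed.

(** The morphism given by the universal property sends T to t, hence F[T] to
    F[t], and sends the three generators to x, y and (s e) + w; so it preserves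
    coordinates. *)
Lemma clifford_to_octo : exists G : C -> O,
  [/\ {morph G : u v / u + v}, G naone = naone, {morph G : u v / u ** v},
      forall k u, G (iota k ** u) = tau k *: G u
    & forall q, G (Theta q) = (quat_map tau q.1, quat_map tau q.2)].
Proof.
have altOF : alternative OF by exact: octo_alternative.
have [G [[Glin G1 GM Ggen] _]] :=
  altClifford_universal altOF octo_gen_linear octo_gen_sqr.
exists G.
have GD : {morph G : u v / u + v}.
  by move=> u v; rewrite -[u]scale1r Glin !scale1r.
have GMO u v : G (u ** v) = (G u : O) ** (G v : O) := GM u v.
have G0 : G 0 = 0 by apply: (addrI (G 0)); rewrite -GD !addr0.
have GN u : G (- u) = - G u by apply: (addrI (G u)); rewrite -GD !subrr.
have GZ k u : G (k *: u) = rho k *: (G u : O).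
  by rewrite -[k *: u]addr0 Glin G0 addr0.
have Gx : G cx = octo_x by rewrite Ggen octo_gen_x.
have Gy : G cy = octo_y by rewrite Ggen octo_gen_y.
have Gz : G cz = octo_z by rewrite Ggen octo_gen_z.
have GT : G T = tau 'X *: (naone : O).
  rewrite -tau_disc -(octo_trace _ _ _ _ (tau s)) /clifford_trace /trace_elt.
  by rewrite !GD GN GZ !GM Gx Gy Gz.
have Giota k : G (iota k) = tau k *: (naone : O).
  exact: (naeval_morph (f := tau) (G := G : C -> O) GD G1 GMO GZ GT).
have Gact k u : G (iota k ** u) = tau k *: G u.
  by rewrite GMO Giota -nascaleAl namul1r.
have Gtheta u : G (theta u) = ((quat_map tau u, 0) : O).
  have [u0 [u1 [u2 [u3 ->]]]] := quatP u.
  rewrite quat_embedE !GD !Gact Giota GMO Gx Gy octo_mul_quatl mul0r.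
  have -> : tau u0 *: (naone : O) + tau u1 *: octo_x + tau u2 *: octo_y +
      tau u3 *: ((quat_x _ _ _ * quat_y _ _ _, 0) : O) =
    (tau u0 *: 1 + tau u1 *: quat_x _ _ _ + tau u2 *: quat_y _ _ _
      + tau u3 *: (quat_x _ _ _ * quat_y _ _ _),
     tau u0 *: 0 + tau u1 *: 0 + tau u2 *: 0 + tau u3 *: 0) :> O by [].
  rewrite !scaler0 !addr0 /quat_x /quat_y (oneQE (tau a%:P)) mulQE !scaleQE.
  by rewrite !addQE; congr (_, _); congr Quat => /=; ring.
split=> // q.
have Gw : G w = ((0, 1) : O).
  rewrite /cd_generator GD GN Gz Gtheta.
  have -> : quat_map tau (s *: quat_e a%:P b%:P m%:P) = tau s *: quat_e _ _ _.
    by rewrite (quat_mapZ tau) (quat_map_e tau).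
  have -> : octo_z - (tau s *: quat_e _ _ _, 0)
    = (tau s *: quat_e _ _ _ - tau s *: quat_e _ _ _, 1 - 0) :> O by [].
  by rewrite subrr subr0.
rewrite clifford_of_pairE GD GMO !Gtheta Gw octo_mul_quatl mulr0 mul1r.
have -> : ((quat_map tau q.1, 0) : O) + (0, quat_map tau q.2)
  = (quat_map tau q.1 + 0, 0 + quat_map tau q.2) by [].
by rewrite addr0 add0r.
Qed.

Let tau_inj : injective tau.
Proof. by move=> k l /eqP; rewrite tofrac_eq => /eqP. Qed.

Lemma octo_disc_neq0 : quat_disc (tau a%:P) (tau b%:P) (tau m%:P) != 0.
Proof.
apply/eqP => disc0; have /esym/eqP := tau_disc.
by rewrite disc0 mulr0 tofrac_eq0 polyX_eq0.
Qed.

(** The coefficient of t^2 is - 1 / D. *)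
Lemma octo_param_neq0 : tau g != 0.
Proof.
rewrite tofrac_eq0 subr_eq0; apply/eqP => cE.
have /(congr1 (fun q : {poly F} => q`_2)) := cE.
rewrite coefC /split_coef -mulrA -expr2 coefCM coefXn /= mulr1 => /esym/eqP.
by rewrite invr_eq0 (negPf D_neq0).
Qed.

(** Write the image of a central u as (p1, p2). Commuting with x and y makes p1
    a scalar; commuting with xy gives p2 (xy - yx) = 0, and (xy - yx)^2 = D. *)
Lemma clifford_center (G : C -> O) : {morph G : u v / u ** v} ->
  (forall q, G (Theta q) = (quat_map tau q.1, quat_map tau q.2)) ->
  forall u, in_center u -> exists k, iota k = u.
Proof.
move=> GM GTheta u [_ uC]; have [[q1 q2] uE] := clifford_of_pair_surj u.
have theta_pair q : theta q = Theta (q, 0).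
  by rewrite clifford_of_pairE (quat_embed0 iD) naring0l addr0.
have Gtheta q : G (theta q) = ((quat_map tau q, 0) : O).
  by rewrite theta_pair GTheta /= /quat_map /= rmorph0.
have Gu : G u = ((quat_map tau q1, quat_map tau q2) : O) by rewrite uE GTheta.
have comm q :
    quat_map tau q1 * quat_map tau q = quat_map tau q * quat_map tau q1 /\
    quat_map tau q2 * quat_conj (quat_map tau q)
      = quat_map tau q2 * quat_map tau q.
  have := congr1 G (uC (theta q)); rewrite !GM Gu Gtheta.
  by rewrite octo_mul_quatl octo_mul_quatr => -[].
have mapx : quat_map tau (quat_x a%:P b%:P m%:P) = quat_x _ _ _.
  by rewrite /quat_map /quat_x /= rmorph0 rmorph1.
have mapy : quat_map tau (quat_y a%:P b%:P m%:P) = quat_y _ _ _.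
  by rewrite /quat_map /quat_y /= rmorph0 rmorph1.
have [k q1E] : exists k, quat_map tau q1 = k%:A.
  apply: (quat_commutant octo_disc_neq0).
    by rewrite -mapx; case: (comm (quat_x _ _ _)).
  by rewrite -mapy; case: (comm (quat_y _ _ _)).
have mapxy : quat_map tau (Quat a%:P b%:P m%:P 0 0 0 1)
    = quat_x _ _ _ * quat_y _ _ _.
  rewrite /quat_map /quat_x /quat_y mulQE /= rmorph0 rmorph1.
  by congr Quat; ring.
have q2E : q2 = 0.
  apply: (quat_map_inj (f := tau) tau_inj).
  have -> : quat_map tau (0 : QR) = 0 by rewrite /quat_map /= rmorph0.
  have [_ /eqP] := comm (Quat _ _ _ 0 0 0 1).
  rewrite eq_sym mapxy -subr_eq0 -mulrBr quat_xy_conj => /eqP Be0.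
  have : quat_map tau q2 * quat_e _ _ _ * quat_e _ _ _ = 0.
    by rewrite Be0 mul0r.
  rewrite -mulrA quat_e_sqr -scalerAr mulr1 => /eqP.
  by rewrite scaler_eq0 (negPf octo_disc_neq0) => /eqP.
move: q1E uE; have [k0 [k1 [k2 [k3 ->]]]] := quatP q1.
rewrite q2E (oneQE (tau a%:P)) scaleQE /quat_map /= !mulr0 -(rmorph0 tau).
move=> -[_ /tau_inj-> /tau_inj-> /tau_inj->] ->; exists k0.
rewrite -theta_pair -(quat_embed_scalar iD i1 iM iC cx cy a%:P b%:P m%:P).
by rewrite oneQE scaleQE !mulr0 mulr1.
Qed.

Lemma fractions_closed (G : C -> O) :
  (forall q, G (Theta q) = (quat_map tau q.1, quat_map tau q.2)) ->
  forall v : O, exists k u, k != 0 /\ v = (tau k)^-1 *: G u.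
Proof.
move=> GTheta [v1 v2].
have [a0 [a1 [a2 [a3 ->]]]] := quatP v1.
have [b0 [b1 [b2 [b3 ->]]]] := quatP v2.
have [d d_neq0 frac] :=
  fraction_common_denom [:: a0; a1; a2; a3; b0; b1; b2; b3].
have fracP j (j8 : (j < 8)%N) :=
  frac _ (@mem_nth _ 0 [:: a0; a1; a2; a3; b0; b1; b2; b3] j j8).
have [n0 /= ->] := fracP 0%N isT; have [n1 /= ->] := fracP 1%N isT.
have [n2 /= ->] := fracP 2%N isT; have [n3 /= ->] := fracP 3%N isT.
have [n4 /= ->] := fracP 4%N isT; have [n5 /= ->] := fracP 5%N isT.
have [n6 /= ->] := fracP 6%N isT; have [n7 /= ->] := fracP 7%N isT.
exists d, (Theta (Quat _ _ _ n0 n1 n2 n3, Quat _ _ _ n4 n5 n6 n7)).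
by split; rewrite // GTheta.
Qed.

Lemma ternary_clifford_structure :
  octonion_ring C /\ center_iso_poly C.
Proof.
have [G [GD G1 GM Gact GTheta]] := clifford_to_octo.
have G0 : G 0 = 0 by apply: (addrI (G 0)); rewrite -GD !addr0.
have G_inj : injective G.
  move=> u v; have [[q1 q2] ->] := clifford_of_pair_surj u.
  have [[r1 r2] ->] := clifford_of_pair_surj v; rewrite !GTheta /=.
  by move=> [/(quat_map_inj tau_inj)-> /(quat_map_inj tau_inj)->].
have Giota k : G (iota k) = tau k *: (naone : O).
  by rewrite -[iota k]namulr1 Gact G1.
have iota_inj : injective iota.
  move=> k l /(congr1 G); rewrite !Giota => tau_kl.
  apply: tau_inj; rewrite -[tau k]mulr1 -[tau l]mulr1.
  exact: (congr1 (fun q : O => q.1.1.1.1) tau_kl).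
split; last first.
  exists iota; split=> //.
    exact: naeval_linear.
  move=> u; split; first exact: (clifford_center GM GTheta).
  by move=> [k <-]; exact: iC.
(* The ring C of scalars in the definition is F[t] itself, and the localization
   is the octonion algebra over F(t). *)
exists {poly F}, iota; split=> //.
  by move=> k k0; apply: iota_inj; rewrite -[LHS]namulr1 k0 (central0 iD).
exists O, G; split; last first.
  exact: (octo_octonion octo_disc_neq0 octo_param_neq0).
split=> //; split=> //; first exact: (fractions_closed GTheta).
move=> u; split=> [Gu0|[k k_neq0 ku0]].
  exists 1; rewrite ?oner_neq0 // i1 namul1r.
  by apply: G_inj; rewrite Gu0 G0.
have /eqP := congr1 G ku0; rewrite Gact G0 scaler_eq0 tofrac_eq0.
by rewrite (negPf k_neq0) => /eqP.
Qed.

End TernaryClifford.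

Theorem theorem1p1 (F : fieldType) (V : vectType F) (phi : V -> F)
    (phi_quad : quadratic_form phi) (phi_nondeg : nondegenerate_quadratic phi)
    (dimV : \dim {:V} = 3%N) :
  octonion_ring (altClifford phi) /\ center_iso_poly (altClifford phi).
Proof.
have [x [y [z [basisV xz0 yz0 disc_neq0 charF]]]] :=
  adapted_basis phi_quad phi_nondeg dimV.
exact: (ternary_clifford_structure phi_quad basisV xz0 yz0 disc_neq0 charF).
Qed.
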